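(* Fix $t\ge0$ and let $x\in(0,1)$ satisfy $x+F_t(r-cx)=1$. Let $\alpha:=cf_t(r-cx)$ and assume that $\alpha\ne1$. Then $$\lim_{\varepsilon\to0}\lim_{n\to\infty}E\big[\#\{k\in\mathcal{K}_{n,t}:\ |x-\tfrac{k}{n}|<\varepsilon\}\big]=\frac{e^{-\alpha}}{|1-\alpha|}.$$ In particular, $$\limsup_{\varepsilon\to0}\limsup_{n\to\infty}P\big(\exists\,k\in\mathcal{K}_{n,t}:\ |x-\tfrac{k}{n}|<\varepsilon\big)\le\frac{e^{-\alpha}}{|1-\alpha|}.$$
   Context: $r\in\mathbb{R}$ and $c>0$ are constants. For the fixed time $t$, the signals $Y^1_t,Y^2_t,\dots$ are i.i.d. $[0,\infty)$-valued random variables on a probability space $(\Omega,\mathcal{G},P)$ with c.d.f. $F_t(y)=P\{Y^i_t\le y\}$, which is assumed to admit a continuous density $f_t$. For $n\ge1$ and integers $k$, set $$G_{n,t}(k)=\#\{i\in\{1,\dots,n\}:\ Y^i_t+c\tfrac{k}{n}\ge r\},$$ and define the random set $$\mathcal{K}_{n,t}=\{0\le k\le n:\ G_{n,t}(k)=k=G_{n,t}(k-1)\}$$ (the values $k$ for which $k/n$ satisfies the $n$-player equilibrium conditions at time $t$). *)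

(* Defs.v *)
From HB Require Import structures.
From mathcomp Require Export all_boot all_order all_algebra.
From mathcomp Require Export all_classical all_reals all_analysis.
Export Order.TTheory GRing.Theory Num.Theory.
Export numFieldNormedType.Exports.

Set Implicit Arguments.
Unset Strict Implicit.
Unset Printing Implicit Defensive.

Local Open Scope classical_set_scope.
Local Open Scope ring_scope.

Definition mutually_independent (d : measure_display) (T : measurableType d)
    (R : realType) (P : probability T R) (Y : nat -> {RV P >-> R}) : Prop :=
  forall (J : seq nat) (B : nat -> set R),
    uniq J -> (forall i, measurable (B i)) ->
    P (\big[setI/setT]_(i <- J) (Y i @^-1` B i)) =
      (\prod_(i <- J) P (Y i @^-1` B i))%E.

Definition identically_distributed (d : measure_display) (T : measurableType d)
    (R : realType) (P : probability T R) (Y : nat -> {RV P >-> R}) : Prop :=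
  forall (i j : nat) (B : set R), measurable B ->
    distribution P (Y i) B = distribution P (Y j) B.

Definition iid (d : measure_display) (T : measurableType d)
    (R : realType) (P : probability T R) (Y : nat -> {RV P >-> R}) : Prop :=
  mutually_independent Y /\ identically_distributed Y.

Definition has_density (R : realType) (F f : R -> R) : Prop :=
  [/\ measurable_fun [set: R] f,
      forall y, 0 <= f y &
      forall y, (F y)%:E =
        (\int[lebesgue_measure]_(u in `]-oo, y]%classic) (f u)%:E)%E].

(* The sequence of signals is indexed from 0: [Y i] is the signal of player
   i + 1. The level [k] is an integer because the equilibrium condition
   evaluates the count at [k - 1], which is -1 for [k = 0]. *)
Definition count_above (R : realType) (T : Type) (Y : nat -> T -> R) (r c : R)
    (n : nat) (k : int) (w : T) : nat :=
  #|[set i : 'I_n | r <= Y i w + c * (k%:~R / n%:R)]%SET|.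

Definition equilibria (R : realType) (T : Type) (Y : nat -> T -> R) (r c : R)
    (n : nat) (w : T) : {set 'I_n.+1} :=
  [set k : 'I_n.+1 | (count_above Y r c n (k : nat)%:Z w == k) &&
                     (count_above Y r c n ((k : nat)%:Z - 1) w == k)]%SET.

Definition equilibria_near (R : realType) (T : Type) (Y : nat -> T -> R)
    (r c x eps : R) (n : nat) (w : T) : {set 'I_n.+1} :=
  [set k in equilibria Y r c n w | `|x - (k : nat)%:R / n%:R| < eps]%SET.

(* Main.v *)
Require Import Defs.
From mathcomp Require Import ring lra measurable_realfun.

Local Open Scope classical_set_scope.
Local Open Scope ring_scope.

Set Implicit Arguments.
Unset Strict Implicit.
Unset Printing Implicit Defensive.

(** Write [h z = 1 - F (r - c z)], so that [h x = x] and [h] has derivative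
    [alpha] at [x].

    Reduction to a sum. The sets of players above the levels for [k] and for
    [k - 1] are nested, so both have [k] elements exactly when they are one and
    the same set [S] of size [k]. Summing over [S], independence gives
    [P (k in K_n) = C(n,k) q^k (1 - p)^(n-k)] with [p = h (k/n)] and
    [q = h ((k-1)/n)] ([prob_pattern], [expected_card_equilibria_near]); there
    are no atoms because the law has a density. This equals
    [(q/p)^k C(n,k) p^k (1 - p)^(n-k)], and since [n (p - q)] tends to [alpha]
    the first factor tends to [exp (- alpha)].

    Shape of the binomial factor. With [z = k/n], the factor
    [C(n,k) p^k (1 - p)^(n-k)] is its maximum over [p], attained at [p = z],
    times [exp (- n KL(z|p))], where [KL(z|p)] is close to
    [(p - z)^2 / (2 x (1 - x))] near [x]. On the scale [k = n x + s sqrt n] one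
    has [sqrt n (p - z) -> (alpha - 1) s], so the exponential tends to
    [exp (- (alpha - 1)^2 s^2 / (2 x (1 - x)))] ([binom_mode_ratio_cvg]).

    Summation without Stirling's formula. The maximum over [p] varies slowly
    with [k] ([mode_term_ratio]), hence may be replaced by its value at the
    integer next to [n x]. After division by this value and by [sqrt n], the sum
    over [k] is the integral of a step function in [s] and converges to a
    Gaussian integral by dominated convergence ([lattice_sum_cvg],
    [laplace_sum]). The unknown normalisation is removed by applying the same
    lemma with the constant [p = x], where the sum is a binomial distribution
    restricted to a window around its mean, hence tends to [1]
    ([binom_window_cvg1]). The ratio of the two Gaussian integrals, whose
    exponents carry the factors [(alpha - 1)^2] and [1], is [1 / |1 - alpha|]
    ([laplace_local], [crossing_sum_cvg]).

    The argument works on every fixed small window, so the limit in [n] does not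
    depend on [eps]; the statement on existence follows from
    [P (N > 0) <= E N] for the integer-valued count [N]. *)

(** * The binomial weights and their maximum over the parameter *)

Section BinomTerm.
Context {R : realType}.

(** This bound and the next one come from [1 + u <= exp u]: they are
    [(1 + 1/k)^k <= e] and [(1 - 1/(m+1))^m <= e^(1/(m+1) - 1)], cleared of
    denominators so that they cover [k = 0] and [m = 0]. *)
Lemma succ_pow_le (k : nat) : k.+1%:R ^+ k <= expR 1 * k%:R ^+ k :> R.
Proof.
case: k => [|k]; first by rewrite !expr0 mulr1 -[leLHS]expR0 ler_expR.
have k0 : 0 < k.+1%:R :> R by rewrite ltr0n.
have -> : k.+2%:R = k.+1%:R * (1 + k.+1%:R^-1) :> R.
  by rewrite mulrDr mulr1 divff ?gt_eqF// -natr1.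
rewrite exprMn mulrC ler_wpM2r ?exprn_ge0 ?ler0n//.
apply: (@le_trans _ _ (expR (k.+1%:R^-1) ^+ k.+1)).
  by rewrite lerXn2r ?nnegrE ?expR_ge0 ?addr_ge0 ?invr_ge0 ?ler0n// expR_ge1Dx.
by rewrite -expRM_natl mulfV ?gt_eqF.
Qed.

Lemma pred_pow_le (m : nat) :
  expR 1 * m%:R ^+ m <= expR m.+1%:R^-1 * m.+1%:R ^+ m :> R.
Proof.
have m0 : 0 < m.+1%:R :> R by rewrite ltr0n.
have -> : m%:R = m.+1%:R * (1 - m.+1%:R^-1) :> R.
  by rewrite mulrBr mulr1 divff ?gt_eqF// -natr1 addrK.
have inv1 : m.+1%:R^-1 <= 1 :> R by rewrite invf_le1// ler1n.
rewrite exprMn [_ ^+ m * _]mulrC mulrA ler_wpM2r ?exprn_ge0 ?ler0n//.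
apply: (@le_trans _ _ (expR 1 * expR (- m.+1%:R^-1) ^+ m)).
  rewrite ler_wpM2l ?expR_ge0// lerXn2r ?nnegrE ?expR_ge0 ?subr_ge0//.
  exact: expR_ge1Dx.
rewrite -expRM_natl -expRD ler_expR mulrN -natr1 -[X in X - _](@divff _ (m%:R + 1)).
  by rewrite -mulrBl addrAC subrr add0r mul1r.
by rewrite natr1 gt_eqF.
Qed.

Definition binom_term (n k : nat) (a b : R) : R :=
  'C(n, k)%:R * a ^+ k * b ^+ (n - k).

(** The weight of [k] under the parameter [k / n] that makes [k] most likely;
    by [0 ^+ 0 = 1] it is [1] at both ends of the range of [k]. *)
Definition mode_term (n k : nat) : R :=
  binom_term n k (k%:R / n%:R) (1 - k%:R / n%:R).

Lemma mode_termE (n k : nat) : (k <= n)%N -> (0 < n)%N ->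
  mode_term n k = 'C(n, k)%:R * k%:R ^+ k * (n - k)%:R ^+ (n - k) / n%:R ^+ n.
Proof.
move=> kn n0; have n0' : n%:R != 0 :> R by rewrite pnatr_eq0 -lt0n.
rewrite /mode_term /binom_term natrB//.
have -> : 1 - k%:R / n%:R = (n%:R - k%:R) / n%:R :> R by rewrite mulrBl divff.
rewrite !expr_div_n (_ : n%:R ^+ n = n%:R ^+ k * n%:R ^+ (n - k) :> R); last first.
  by rewrite -exprD subnKC.
by field; rewrite !expf_neq0.
Qed.

Lemma mode_term_sym (n k : nat) : (k <= n)%N -> (0 < n)%N ->
  mode_term n (n - k) = mode_term n k.
Proof.
move=> kn n0; rewrite mode_termE ?leq_subr// mode_termE// bin_sub// subKn//.
by congr (_ / _); rewrite mulrAC.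
Qed.

(** The quotient of consecutive values is
    [((k+1)/k)^k ((m-1)/m)^(m-1)] with [m = n - k]: the two factors are close to
    [e] and [1/e], and only the [O(1/m)] error survives. *)
Lemma mode_term_succ_le (n k : nat) : (k < n)%N ->
  mode_term n k.+1 <= expR (n - k)%:R^-1 * mode_term n k.
Proof.
move=> kn; have n0 : (0 < n)%N by case: n kn.
rewrite !mode_termE ?(ltnW kn)// mulrA ler_wpM2r ?invr_ge0 ?exprn_ge0 ?ler0n//.
have [m nkE] : exists m, (n - k = m.+1)%N.
  by case: (n - k)%N (subn_gt0 k n) => [|m _]; [rewrite kn|exists m].
rewrite subnS nkE /=.
rewrite exprS mulrA -natrM mulnC mul_bin_left mulnC natrM nkE.
rewrite exprS.
set c := 'C(n, k)%:R.
have := ler_pM (exprn_ge0 k (ler0n R k.+1)) (mulr_ge0 (expR_ge0 1) (exprn_ge0 m (ler0n R m))) (succ_pow_le k) (pred_pow_le m).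
rewrite (_ : _ * (expR 1 * _) = expR 1 * (k.+1%:R ^+ k * m%:R ^+ m)); last by ring.
rewrite -[leRHS]mulrA ler_pM2l ?expR_gt0// => H.
rewrite (_ : c * _ * _ * _ = c * m.+1%:R * (k.+1%:R ^+ k * m%:R ^+ m)); last by ring.
apply: (le_trans (ler_wpM2l _ H)); first by rewrite mulr_ge0 ?ler0n.
by rewrite le_eqVlt; apply/orP; left; apply/eqP; ring.
Qed.

(** Follows from the previous bound by the symmetry [k <-> n - k]. *)
Lemma mode_term_le_succ (n k : nat) : (k < n)%N ->
  mode_term n k <= expR k.+1%:R^-1 * mode_term n k.+1.
Proof.
move=> kn; have n0 : (0 < n)%N by case: n kn.
have := @mode_term_succ_le n (n - k.+1) _.
rewrite ltn_subrL n0 => /(_ isT).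
rewrite -subSn// subSS subKn// !mode_term_sym//; exact: ltnW.
Qed.

Lemma binom_term_ge0 (n k : nat) (a b : R) : 0 <= a -> 0 <= b ->
  0 <= binom_term n k a b.
Proof. by move=> a0 b0; rewrite /binom_term !mulr_ge0 ?exprn_ge0 ?ler0n. Qed.

Lemma mode_term_ge0 (n k : nat) : (k <= n)%N -> 0 <= mode_term n k.
Proof.
move=> kn; apply: binom_term_ge0; first by rewrite divr_ge0 ?ler0n.
rewrite subr_ge0; case: n kn => [|n] kn; first by rewrite invr0 mulr0.
by rewrite ler_pdivrMr ?ltr0n// mul1r ler_nat.
Qed.

(** With [e] proportional to [n], moving [k] by [j] changes the maximum by a
    factor [exp (O(j/n))]: negligible on the scale [sqrt n], and bounded on a
    window of length proportional to [n]. This replaces Stirling's formula. *)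
Lemma mode_term_slow (n k j : nat) (e : R) : 0 < e ->
  e <= k%:R -> e <= (n - (k + j))%:R -> 
  mode_term n (k + j) <= expR (j%:R / e) * mode_term n k /\
  mode_term n k <= expR (j%:R / e) * mode_term n (k + j).
Proof.
move=> e0 ek; elim: j => [|j IH] ekj.
  by rewrite addn0 mul0r expR0 mul1r.
have kjn : (k + j < n)%N.
  by rewrite ltnNge; apply/negP => nkj; move: ekj; rewrite addnS subnS (eqP nkj)/= leNgt e0.
have enkj : e <= (n - (k + j))%:R.
  by apply: (le_trans ekj); rewrite ler_nat addnS subnS leq_pred.
have [IH1 IH2] := IH enkj.
have jE : j.+1%:R / e = e^-1 + j%:R / e by rewrite -natr1 mulrDl mul1r addrC.
rewrite addnS jE expRD; split.
  apply: (le_trans (mode_term_succ_le kjn)).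
  rewrite -mulrA; apply: ler_pM; [exact: expR_ge0| | |by []].
    exact/mode_term_ge0/ltnW.
  by rewrite ler_expR lef_pV2 ?posrE// (lt_le_trans e0).
rewrite [_ * expR _]mulrC -mulrA; apply: (le_trans IH2).
rewrite ler_wpM2l ?expR_ge0//; apply: (le_trans (mode_term_le_succ kjn)).
rewrite ler_wpM2r ?mode_term_ge0// ler_expR lef_pV2 ?posrE ?ltr0n//.
by apply: (le_trans ek); rewrite ler_nat -addnS leq_addr.
Qed.

Lemma sum_binom_term (n : nat) (a : R) :
  \sum_(i < n.+1) binom_term n i a (1 - a) = 1.
Proof.
rewrite -[RHS](expr1n _ n) -[in RHS](subrK a 1) exprDn.
by apply: eq_bigr => i _; rewrite /binom_term -[in RHS]mulr_natl -mulrA [a ^+ i * _]mulrC.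
Qed.

Lemma binom_term_le1 (n k : nat) (a : R) : (k <= n)%N -> 0 <= a <= 1 ->
  binom_term n k a (1 - a) <= 1.
Proof.
move=> kn /andP[a0 a1]; rewrite -ltnS in kn.
rewrite -[leRHS](sum_binom_term n a) (bigD1 (Ordinal kn))//= lerDl.
by apply: sumr_ge0 => i _; rewrite binom_term_ge0 ?subr_ge0.
Qed.

End BinomTerm.

(** * Gaussian bounds for the binomial weights *)

Section Likelihood.
Context {R : realType}.

Lemma MVT_between (f df : R -> R) (a b : R) :
  (forall u, Num.min a b <= u <= Num.max a b -> is_derive u 1 f (df u)) ->
  exists2 c : R, Num.min a b <= c <= Num.max a b & f b - f a = df c * (b - a).
Proof.
wlog ab : a b / a <= b.
  move=> H fdf; have /orP[/H|ba] := le_total a b; first by apply.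
  have [|c cab fE] := H b a ba; first by rewrite minC maxC.
  by exists c; rewrite 1?minC 1?maxC// -opprB fE -mulrN opprB.
rewrite /Num.min /Num.max; case: ltgtP ab => // [ab|<-] _ fdf; last first.
  by exists a; rewrite ?lexx// !subrr mulr0.
have [||c] := @MVT _ f df a b ab.
- by move=> u; rewrite in_itv/= => /andP[/ltW au /ltW ub]; apply: fdf; rewrite au ub.
- apply: derivable_within_continuous => u; rewrite in_itv/= => uab.
  by have [] := fdf _ uab.
- by rewrite in_itv/= => /andP[/ltW au /ltW ub] ->; exists c; rewrite ?au.
Qed.

(** The Bernoulli log-likelihood; [bern_loglik z z - bern_loglik z p] is the
    relative entropy of the Bernoulli laws with parameters [z] and [p]. *)
Definition bern_loglik (z p : R) : R := z * ln p + (1 - z) * ln (1 - p).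

Lemma is_derive_bern_loglik (z u : R) : 0 < u < 1 ->
  is_derive u 1 (bern_loglik z) (z / u - (1 - z) / (1 - u)).
Proof.
move=> /andP[u0 u1].
have u1' : 0 < 1 - u by rewrite subr_gt0.
have H1 := is_derive1_ln u0.
have H2 : is_derive u 1 (fun v : R => ln (1 - v)) (- (1 - u)^-1).
  have H3 := is_derive1_ln u1'.
  have H4 : is_derive u 1 (fun v : R => 1 - v) (- 1).
    by rewrite -[- 1]add0r; apply: is_deriveB.
  have := @is_derive1_comp R (@ln R) (fun v : R => 1 - v) u _ _ H3 H4.
  by rewrite mulrN1.
rewrite /bern_loglik.
have -> : z / u - (1 - z) / (1 - u) = z *: u^-1 + (1 - z) *: (- (1 - u)^-1).
  by rewrite scalerN.
exact: is_deriveD (is_deriveZ z H1) (is_deriveZ (1 - z) H2).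
Qed.

(** The derivative of [u |-> bern_loglik z u + (u - z)^2 / (2 w)] is
    [(z - u) (1 / (u (1 - u)) - 1 / w)], so comparing [w] with [u (1 - u)]
    decides whether this function increases or decreases towards [z]. The sign
    [s] covers the upper and the lower bound by one proof; in the upper bound
    [w = 1/4] is always admissible and gives Pinsker's inequality. *)
Lemma bern_loglik_quadratic (z p w s : R) : 0 < z < 1 -> 0 < p < 1 -> 0 < w ->
  (forall u, Num.min p z <= u <= Num.max p z -> 0 <= s * (w - u * (1 - u))) ->
  s * (bern_loglik z p - bern_loglik z z) <= s * - ((p - z) ^+ 2 / (2 * w)).
Proof.
move=> z01 p01 w0 uw.
pose psi u := bern_loglik z u + (u - z) ^+ 2 / (2 * w).
pose dpsi u := z / u - (1 - z) / (1 - u) + (u - z) / w.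
have u01 u : Num.min p z <= u <= Num.max p z -> 0 < u < 1.
  move=> /andP[h1 h2]; move: z01 p01 => /andP[z0 z1] /andP[p0 p1].
  by rewrite (lt_le_trans _ h1) ?lt_min ?z0 ?p0// (le_lt_trans h2)// gt_max z1 p1.
have [u pzu|c pzc cE] := @MVT_between psi dpsi p z.
  have H1 := is_derive_bern_loglik z (u01 _ pzu).
  have H3 : is_derive u 1 (fun v : R => v - z) (1 : R).
    by rewrite -[X in is_derive _ _ _ X]subr0; apply: is_deriveB.
  have H4 := is_deriveD H1 (is_deriveZ (2 * w)^-1 (is_deriveX 2 H3)).
  have psiE : psi = bern_loglik z + (2 * w)^-1 *: (fun v : R => v - z) ^+ 2.
    by apply/funext => v /=; rewrite /psi !fctE; congr (_ + _); rewrite mulrC.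
  rewrite psiE; apply: (is_derive_eq H4); rewrite /dpsi.
  rewrite /GRing.scale/= expr1 mulr1; congr (_ + _).
  by have w0' : w != 0 by [rewrite gt_eqF]; field.
have /andP[c0 c1] := u01 _ pzc.
have c1' : 0 < 1 - c by rewrite subr_gt0.
have dE : dpsi c = (z - c) * ((w - c * (1 - c)) / (c * (1 - c) * w)).
  have c0n : c != 0 by rewrite gt_eqF.
  have w0n : w != 0 by rewrite gt_eqF.
  have c1n : 1 - c != 0 by rewrite gt_eqF.
  by rewrite /dpsi; field; rewrite c0n w0n c1n.
have : 0 <= s * (psi z - psi p).
  rewrite cE dE.
  rewrite (_ : s * _ = (z - c) * (z - p) * (s * (w - c * (1 - c))) / (c * (1 - c) * w)); last by ring.
  apply: mulr_ge0; last by rewrite invr_ge0 !mulr_ge0 ?ltW.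
  apply: mulr_ge0; last exact: uw.
  move: pzc; rewrite /Num.min /Num.max; case: ltP => pz /andP[h1 h2].
    by apply: mulr_ge0; rewrite subr_ge0// ltW.
  by apply: mulr_le0; rewrite subr_le0.
rewrite /psi subrr expr0n/= mul0r addr0 => H.
by rewrite -subr_ge0 (_ : _ - _ = s * (bern_loglik z z - (bern_loglik z p + (p - z) ^+ 2 / (2 * w)))) //; ring.
Qed.

Lemma expR_bern_loglik (n k : nat) (p : R) : (k <= n)%N -> (0 < n)%N -> 0 < p < 1 ->
  expR (n%:R * bern_loglik (k%:R / n%:R) p) = p ^+ k * (1 - p) ^+ (n - k).
Proof.
move=> kn n0 /andP[p0 p1].
have n0' : n%:R != 0 :> R by rewrite pnatr_eq0 -lt0n.
rewrite /bern_loglik (_ : n%:R * _ = k%:R * ln p + (n - k)%:R * ln (1 - p)); last first.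
  by rewrite natrB//; field.
by rewrite expRD !expRM_natl !lnK// posrE// subr_gt0.
Qed.

Lemma binom_term_mode (n k : nat) (p : R) : (0 < k < n)%N -> 0 < p < 1 ->
  let z := k%:R / n%:R in
  binom_term n k p (1 - p) =
  mode_term n k * expR (n%:R * (bern_loglik z p - bern_loglik z z)).
Proof.
move=> /andP[k0 kn] p01 z.
have n0 : (0 < n)%N by exact: ltn_trans kn.
have z01 : 0 < z < 1.
  by rewrite divr_gt0 ?ltr0n//= ltr_pdivrMr ?ltr0n// mul1r ltr_nat.
rewrite /mode_term /binom_term -/z.
rewrite -[LHS]mulrA -expR_bern_loglik ?(ltnW kn)// -/z.
rewrite -[X in _ = X * _]mulrA -[X in _ = _ * X * _]expR_bern_loglik ?(ltnW kn)// -/z.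
by rewrite -mulrA -expRD mulrBr subrKC.
Qed.

Lemma binom_term_upper (n k : nat) (p w : R) : (0 < k < n)%N -> 0 < p < 1 ->
  0 < w -> let z := k%:R / n%:R in
  (forall u, Num.min p z <= u <= Num.max p z -> u * (1 - u) <= w) ->
  binom_term n k p (1 - p) <= mode_term n k * expR (- (n%:R * (p - z) ^+ 2 / (2 * w))).
Proof.
move=> /andP[k0 kn] p01 w0 z uw.
have n0 : (0 < n)%N by exact: ltn_trans kn.
have z01 : 0 < z < 1.
  by rewrite divr_gt0 ?ltr0n//= ltr_pdivrMr ?ltr0n// mul1r ltr_nat.
rewrite binom_term_mode ?k0// ler_wpM2l ?mode_term_ge0 ?(ltnW kn)// ler_expR.
rewrite -mulrA -mulrN ler_wpM2l// -/z.
have := @bern_loglik_quadratic z p w 1 z01 p01 w0; rewrite !mul1r; apply.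
by move=> u /uw; rewrite mul1r subr_ge0.
Qed.

Lemma binom_term_lower (n k : nat) (p w : R) : (0 < k < n)%N -> 0 < p < 1 ->
  0 < w -> let z := k%:R / n%:R in
  (forall u, Num.min p z <= u <= Num.max p z -> w <= u * (1 - u)) ->
  mode_term n k * expR (- (n%:R * (p - z) ^+ 2 / (2 * w))) <= binom_term n k p (1 - p).
Proof.
move=> /andP[k0 kn] p01 w0 z uw.
have n0 : (0 < n)%N by exact: ltn_trans kn.
have z01 : 0 < z < 1.
  by rewrite divr_gt0 ?ltr0n//= ltr_pdivrMr ?ltr0n// mul1r ltr_nat.
rewrite binom_term_mode ?k0// ler_wpM2l ?mode_term_ge0 ?(ltnW kn)// ler_expR.
rewrite -mulrA -mulrN ler_wpM2l// -/z.
have := @bern_loglik_quadratic z p w (-1) z01 p01 w0; rewrite !mulN1r lerN2; apply.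
by move=> u /uw; rewrite mulN1r opprB subr_ge0.
Qed.
End Likelihood.

(** * Lattice sums as Gaussian integrals *)

Section LatticeSum.
Context {R : realType}.
Local Notation mu := (@lebesgue_measure R).

Lemma gaussE (b s : R) : 0 < b ->
  expR (- (b * s ^+ 2)) =
  Num.sqrt (pi / b) * normal_pdf 0 (Num.sqrt (2 * b)^-1) s.
Proof.
move=> b0; have b2 : 0 < (2 * b)^-1 by rewrite invr_gt0 mulr_gt0.
rewrite normal_pdfE ?gt_eqF ?sqrtr_gt0// /normal_peak /normal_fun subr0.
rewrite sqr_sqrtr ?(ltW b2)//.
have -> : (2 * b)^-1 * pi *+ 2 = pi / b by have ? : b != 0 by [rewrite gt_eqF]; field.
rewrite mulVKf ?gt_eqF ?sqrtr_gt0 ?divr_gt0 ?pi_gt0//.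
by congr expR; have ? : b != 0 by [rewrite gt_eqF]; field.
Qed.

Lemma integral_gauss (b : R) : 0 < b ->
  (\int[mu]_s (expR (- (b * s ^+ 2)))%:E)%E = (Num.sqrt (pi / b))%:E.
Proof.
move=> b0; under eq_integral do rewrite (gaussE _ b0) EFinM.
by rewrite integralZl//= ?integral_normal_pdf ?mule1//; exact: integrable_normal_pdf.
Qed.

Lemma integrable_gauss (b : R) : 0 < b ->
  mu.-integrable setT (fun s => (expR (- (b * s ^+ 2)))%:E).
Proof.
move=> b0; under eq_fun do rewrite (gaussE _ b0) EFinM.
by apply: integrableZl => //; exact: integrable_normal_pdf.
Qed.

(** The integer below [n x + s sqrt n]. The absolute value only matters for
    the finitely many [n] at which this number is negative. *)
Definition scaled_idx (x : R) (n : nat) (s : R) : nat :=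
  `|Num.floor (n%:R * x + s * Num.sqrt n%:R)|%N.

(** The values of [s] for which [k] is the integer part of [n x + s sqrt n], an
    interval of length [1 / sqrt n]. *)
Definition cell (x : R) (n k : nat) : set R :=
  `[(k%:R - n%:R * x) / Num.sqrt n%:R, (k.+1%:R - n%:R * x) / Num.sqrt n%:R[.

Lemma cellP (x : R) (n k : nat) (s : R) : (0 < n)%N ->
  cell x n k s <-> k%:R <= n%:R * x + s * Num.sqrt n%:R < k.+1%:R.
Proof.
move=> n0; have rn0 : 0 < Num.sqrt n%:R :> R by rewrite sqrtr_gt0 ltr0n.
by rewrite /cell /= in_itv/= ler_pdivrMr// ltr_pdivlMr// lerBlDl ltrBrDl.
Qed.

Lemma cell_idx (x : R) (n k : nat) (s : R) : (0 < n)%N ->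
  cell x n k s -> k = scaled_idx x n s.
Proof.
move=> n0 /(cellP _ _ _ n0) ks; rewrite /scaled_idx.
suff -> : Num.floor (n%:R * x + s * Num.sqrt n%:R) = k%:Z by rewrite absz_nat.
by apply: floor_def; rewrite -[(k%:Z + 1)%:~R]/((k + 1)%N%:R) addn1.
Qed.

Lemma idx_cell (x : R) (n : nat) (s : R) : (0 < n)%N ->
  0 <= n%:R * x + s * Num.sqrt n%:R -> cell x n (scaled_idx x n s) s.
Proof.
move=> n0 s0; apply/cellP => //; rewrite /scaled_idx.
have := floor_itv (n%:R * x + s * Num.sqrt n%:R).
set m := Num.floor _ => mm.
have m0 : 0 <= m by rewrite floor_ge0.
by rewrite -[m]gez0_abs// -[(_ + 1)%:~R]/((_ + 1)%N%:R) addn1 in mm.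
Qed.

Lemma integral_cell (x : R) (n k : nat) : (0 < n)%N ->
  mu (cell x n k) = ((Num.sqrt n%:R)^-1)%:E.
Proof.
move=> n0; have rn0 : 0 < Num.sqrt n%:R :> R by rewrite sqrtr_gt0 ltr0n.
rewrite /cell lebesgue_measure_itv/= lte_fin ltr_pM2r ?invr_gt0// ltrD2r ltr_nat ltnSn.
by rewrite -EFinB -mulrBl -natr1; congr (_%:E); rewrite opprB [_ - _ + _]addrC; field; rewrite gt_eqF.
Qed.

(** A sum over [k] is turned into an integral over [s] by spreading the term
    [c n k] uniformly on the cell of [k]. *)
Definition step_fun (x : R) (c : nat -> nat -> R) (n : nat) (s : R) : R :=
  \sum_(k < n.+1) (Num.sqrt n%:R * c n k) * \1_(cell x n k) s.

Lemma step_fun_cell x c n k s : (0 < n)%N -> (k <= n)%N -> cell x n k s ->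
  step_fun x c n s = Num.sqrt n%:R * c n k.
Proof.
move=> n0 kn sk; rewrite /step_fun (bigD1 (Ordinal (kn : (k < n.+1)%N)))//=.
rewrite indicE mem_set// mulr1 big1 ?addr0// => i /eqP ik.
rewrite indicE memNset ?mulr0// => si; apply: ik; apply: val_inj => /=.
by rewrite (cell_idx n0 sk) (cell_idx n0 si).
Qed.

Lemma step_fun_out x c n s : (forall k, (k <= n)%N -> ~ cell x n k s) ->
  step_fun x c n s = 0.
Proof.
move=> sk; rewrite /step_fun big1// => i _.
by rewrite indicE memNset ?mulr0//; apply: sk; rewrite -ltnS.
Qed.

Lemma integral_step_fun x c n : (0 < n)%N -> (forall k, (k <= n)%N -> 0 <= c n k) ->
  (\int[mu]_s (step_fun x c n s)%:E)%E = (\sum_(k < n.+1) c n k)%:E.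
Proof.
move=> n0 c0; have rn0 : 0 < Num.sqrt n%:R :> R by rewrite sqrtr_gt0 ltr0n.
rewrite /step_fun; under eq_integral do rewrite -sumEFin.
rewrite ge0_integral_sum//=.
- rewrite -sumEFin; apply: eq_bigr => i _.
  under eq_integral do rewrite EFinM.
  have ci : 0 <= c n i by apply: c0; rewrite -ltnS.
  rewrite ge0_integralZl_EFin//=; last 2 first.
  - by apply/measurable_EFinP; apply: measurable_indic; exact: measurable_itv.
  - by rewrite mulr_ge0// ltW.
  rewrite integral_indic//; last exact: measurable_itv.
  rewrite setIT.
  rewrite [X in (_ * X)%E](_ : _ = ((Num.sqrt n%:R)^-1)%:E); last exact: integral_cell.
  by rewrite -EFinM mulrAC divff ?mul1r// gt_eqF.
- move=> i; apply/measurable_EFinP; apply: measurable_funM => //.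
  by apply: measurable_indic; exact: measurable_itv.
- by move=> i s _; rewrite lee_fin !mulr_ge0 ?(ltW rn0) ?c0// -ltnS.
Qed.

Lemma sqrt_nat_cvgy : Num.sqrt (n%:R : R) @[n --> \oo] --> +oo.
Proof.
apply/cvgryPge => A; near=> n.
have [A0|A0] := leP A 0; first by rewrite (le_trans A0).
rewrite -(ger0_norm (ltW A0)) -sqrtr_sqr ler_sqrt ?ler0n//.
by near: n; exact: nbhs_infty_ger.
Unshelve. all: by end_near.
Qed.

Lemma scaled_pos_range (x s : R) : 0 < x < 1 ->
  \forall n \near \oo, (0 < n)%N /\ 0 <= n%:R * x + s * Num.sqrt n%:R < n%:R.
Proof.
move=> /andP[x0 x1]; near=> n.
have n0 : (0 < n)%N by near: n; exact: nbhs_infty_gt.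
split=> //.
have rn0 : 0 < Num.sqrt n%:R :> R by rewrite sqrtr_gt0 ltr0n.
have nE : n%:R = Num.sqrt n%:R * Num.sqrt n%:R :> R by rewrite -expr2 sqr_sqrtr ?ler0n.
have h1 : - s / x <= Num.sqrt n%:R by near: n; move/cvgryPge : sqrt_nat_cvgy; apply.
have h2 : s / (1 - x) < Num.sqrt n%:R by near: n; move/cvgryPgt : sqrt_nat_cvgy; apply.
rewrite ler_pdivrMr// in h1; rewrite ltr_pdivrMr ?subr_gt0// in h2.
apply/andP; split; first by rewrite [X in X * _ + _]nE; nra.
by rewrite nE -nE; nra.
Unshelve. all: by end_near.
Qed.

(** Dominated convergence for [step_fun]: at a fixed [s] the step function
    reads the term of index [scaled_idx x n s], and the Gaussian bound at the left
    end of a cell costs only constants on the rest of the cell, whose length is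
    at most one. *)
Lemma lattice_sum_cvg (x a C : R) (c : nat -> nat -> R) (g : R -> R) :
  0 < x < 1 -> 0 < a -> measurable_fun setT g ->
  (\forall n \near \oo, forall k, (k <= n)%N ->
    0 <= c n k /\
    Num.sqrt n%:R * c n k <= C * expR (- (a * ((k%:R - n%:R * x) / Num.sqrt n%:R) ^+ 2))) ->
  (forall s, Num.sqrt n%:R * c n (scaled_idx x n s) @[n --> \oo] --> g s) ->
  (\sum_(k < n.+1) c n k)%:E @[n --> \oo] --> (\int[mu]_s (g s)%:E)%E.
Proof.
move=> x01 a0 mg [N _ cN] cg.
have C0 : 0 <= C.
  have [c0] := cN N.+1 (leqnSn N) 0%N isT.
  move=> /(le_trans _)-/(_ 0); rewrite mulr_ge0 ?sqrtr_ge0// => /(_ isT).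
  by rewrite pmulr_lge0// expR_gt0.
rewrite -(cvg_shiftn N.+1) /=.
pose G s := C * expR a * expR (- (a / 2 * s ^+ 2)).
have -> : (fun n => (\sum_(k < (n + N.+1).+1) c (n + N.+1)%N k)%:E) =
          (fun n => \int[mu]_s (step_fun x c (n + N.+1) s)%:E)%E.
  apply/funext => n; rewrite integral_step_fun//; [by rewrite addnS|move=> k kn].
  by case: (cN (n + N.+1)%N _ k kn) => //=; rewrite addnS leqW// leq_addl.
apply: (@dominated_cvg _ _ _ mu setT measurableT
   (fun n s => (step_fun x c (n + N.+1) s)%:E) (EFin \o g) (EFin \o G)) => //.
- move=> n; apply/measurable_EFinP; apply: measurable_sum => k.
  by apply: measurable_funM => //; apply: measurable_indic; exact: measurable_itv.
- move=> s _; rewrite (cvg_shiftn N.+1 (fun n => (step_fun x c n s)%:E)).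
  apply: cvg_EFin; first by near=> n.
  apply: cvg_trans (cg s); apply: near_eq_cvg; near=> n => /=.
  have [n0 /andP[h0 h1]] : (0 < n)%N /\ 0 <= n%:R * x + s * Num.sqrt n%:R < n%:R.
    by near: n; exact: scaled_pos_range.
  have h := idx_cell n0 h0.
  rewrite (step_fun_cell _ n0 _ h)//.
  move/(cellP _ _ _ n0) : h => /andP[h2 _].
  by have := le_lt_trans h2 h1; rewrite ltr_nat => /ltnW.
- have -> : EFin \o G =
      (fun s => ((C * expR a)%:E * (expR (- (a / 2 * s ^+ 2)))%:E)%E).
    by apply/funext => s; rewrite /G /= EFinM.
  by apply: integrableZl => //; apply: integrable_gauss; rewrite divr_gt0.
- move=> n s _; rewrite /= lee_fin.
  set m := (n + N.+1)%N; have m0 : (0 < m)%N by rewrite /m addnS.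
  have rm0 : 1 <= Num.sqrt m%:R :> R by rewrite -[leLHS]sqrtr1 ler_sqrt// ?ler0n// ler1n.
  have [[k [km sk]]|nk] := pselect (exists k, (k <= m)%N /\ cell x m k s); last first.
    rewrite step_fun_out ?normr0 ?mulr_ge0 ?expR_ge0// => k km ?.
    by apply: nk; exists k.
  rewrite (step_fun_cell _ m0 km sk).
  have [|c0 cle] := cN m _ k km; first by rewrite /m addnS/= leqW// leq_addl.
  rewrite ger0_norm ?mulr_ge0 ?sqrtr_ge0//; apply: (le_trans cle).
  rewrite /G -mulrA ler_wpM2l// -expRD ler_expR.
  set sk0 := (_ - _) / _.
  (* [sk0] is the left end of the cell of [s]. *)
  suff : s ^+ 2 <= 2 * sk0 ^+ 2 + 2 by move=> ?; nra.
  have : `|s - sk0| <= 1.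
    move: sk; rewrite /cell/= in_itv/= -/sk0 => /andP[h1 h2].
    rewrite ger0_norm ?subr_ge0// lerBlDl (le_trans (ltW h2))//.
    rewrite -natr1 addrAC mulrDl -/sk0 lerD2l div1r invf_le1// (lt_le_trans _ rm0)//.
  rewrite ler_norml => /andP[h1 h2].
  have : (s - sk0) ^+ 2 <= 1 by nra.
  have := sqr_ge0 (s - 2 * sk0); nra.
Unshelve. all: by end_near.
Qed.
End LatticeSum.

(** * Indices on the central limit scale *)

Section Scale.
Context {R : realType}.
Local Notation mu := (@lebesgue_measure R).
Local Notation rt n := (Num.sqrt (n%:R : R)).

Lemma inv_sqrt_nat_cvg0 : (rt n)^-1 @[n --> \oo] --> 0.
Proof.
apply/gtr0_cvgV0; last exact: sqrt_nat_cvgy.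
by near=> n; rewrite sqrtr_gt0 ltr0n; near: n; exact: nbhs_infty_gt.
Unshelve. all: by end_near.
Qed.

Lemma scaled_idx_close (x s : R) n : (0 < n)%N -> 0 <= n%:R * x + s * rt n ->
  `|(scaled_idx x n s)%:R - (n%:R * x + s * rt n)| <= 1.
Proof.
move=> n0 s0; have /(cellP _ _ _ n0) := idx_cell n0 s0.
by rewrite -natr1 => /andP[h1 h2]; rewrite ler_norml; lra.
Qed.

Lemma scaled_idx_cvg (x s : R) : 0 < x < 1 ->
  rt n * ((scaled_idx x n s)%:R / n%:R - x) @[n --> \oo] --> s.
Proof.
move=> x01.
have h1 : s - (rt n)^-1 @[n --> \oo] --> s.
  rewrite -[X in _ --> X]subr0; apply: cvgB; [exact: cvg_cst|exact: inv_sqrt_nat_cvg0].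
have h2 : s + (rt n)^-1 @[n --> \oo] --> s.
  rewrite -[X in _ --> X]addr0; apply: cvgD; [exact: cvg_cst|exact: inv_sqrt_nat_cvg0].
apply: (squeeze_cvgr _ h1 h2); near=> n.
have [n0 /andP[g0 _]] : (0 < n)%N /\ 0 <= n%:R * x + s * rt n < n%:R.
  by near: n; exact: scaled_pos_range.
have rn0 : 0 < rt n by rewrite sqrtr_gt0 ltr0n.
have nE : n%:R = rt n * rt n :> R by rewrite -expr2 sqr_sqrtr ?ler0n.
have := scaled_idx_close n0 g0.
set K := (scaled_idx _ _ _)%:R.
set r := rt n in rn0 nE *; rewrite ler_norml => /andP[k1 k2].
have -> : r * (K / n%:R - x) = s + (K - (n%:R * x + s * r)) / r.
  by rewrite nE; field; rewrite gt_eqF.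
rewrite !lerD2l -mulN1r -[X in _ && (_ <= X)]mul1r.
by rewrite !ler_pM2r ?invr_gt0// k1.
Unshelve. all: by end_near.
Qed.

Lemma cvg_div_sqrt_nat (u : R ^nat) (l s : R) :
  rt n * (u n - l) @[n --> \oo] --> s -> u n @[n --> \oo] --> l.
Proof.
move=> us.
have : (rt n)^-1 * (rt n * (u n - l)) + l @[n --> \oo] --> 0 * s + l.
  by apply: cvgD; [apply: cvgM => //; exact: inv_sqrt_nat_cvg0|exact: cvg_cst].
rewrite mul0r add0r; apply: cvg_trans; apply: near_eq_cvg; near=> n.
have rn0 : rt n != 0.
  by rewrite gt_eqF// sqrtr_gt0 ltr0n; near: n; exact: nbhs_infty_gt.
by rewrite mulKf// subrK.
Unshelve. all: by end_near.
Qed.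

Lemma scaled_idx_div_cvg (x s : R) : 0 < x < 1 ->
  (scaled_idx x n s)%:R / n%:R @[n --> \oo] --> x.
Proof. by move=> x01; apply: cvg_div_sqrt_nat; exact: scaled_idx_cvg. Qed.

Lemma mode_term_ratio (n k k' : nat) (e : R) : 0 < e ->
  e <= k%:R -> e <= (n - k)%:R -> e <= k'%:R -> e <= (n - k')%:R ->
  mode_term n k <= expR (`|k%:R - k'%:R| / e) * mode_term n k'.
Proof.
move=> e0 h1 h2 h3 h4; have [kk|kk] := leqP k k'.
  have := @mode_term_slow R n k (k' - k) e e0 h1; rewrite subnKC// => /(_ h4)[_].
  by rewrite natrB// distrC ger0_norm// subr_ge0 ler_nat.
have := @mode_term_slow R n k' (k - k') e e0 h3; rewrite subnKC ?(ltnW kk)// => /(_ h2)[+ _].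
by rewrite natrB ?(ltnW kk)// ger0_norm// subr_ge0 ler_nat ltnW.
Qed.

Lemma mode_term_gt0 (n k : nat) : (0 < k < n)%N -> 0 < mode_term n k :> R.
Proof.
move=> /andP[k0 kn]; have n0 : (0 < n)%N by exact: ltn_trans kn.
rewrite mode_termE ?(ltnW kn)// divr_gt0 ?exprn_gt0 ?ltr0n// !mulr_gt0 ?exprn_gt0 ?ltr0n//.
  by rewrite bin_gt0 ltnW.
by rewrite subn_gt0.
Qed.

Definition in_window (x eps : R) (n k : nat) : bool := `|x - k%:R / n%:R| < eps.

Lemma in_window_bounds (x eps : R) (n k : nat) : 2 * eps <= x -> 2 * eps <= 1 - x ->
  0 < eps -> (0 < n)%N -> (k <= n)%N -> in_window x eps n k ->
  [/\ (0 < k < n)%N, eps * n%:R <= k%:R & eps * n%:R <= (n - k)%:R].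
Proof.
move=> ex e1x e0 n0 kn; have n0' : 0 < n%:R :> R by rewrite ltr0n.
rewrite /in_window ltr_norml => /andP[h1 h2].
have kz : k%:R = (k%:R / n%:R) * n%:R :> R by rewrite divfK// gt_eqF.
have H1 : eps * n%:R < k%:R by rewrite kz ltr_pM2r//; lra.
have H2 : eps * n%:R < (n - k)%:R.
  by rewrite natrB// [X in _ < _ - X]kz -[X in _ < X - _]mul1r -mulrBl ltr_pM2r//; lra.
have en : 0 < eps * n%:R by rewrite mulr_gt0.
split; [|exact: ltW|exact: ltW].
have := lt_trans en H1; rewrite ltr0n => ->.
by have := lt_trans en H2; rewrite ltr0n subn_gt0.
Qed.

Lemma in_window_near (x eps s : R) : 0 < x < 1 -> 0 < eps ->
  \forall n \near \oo, (0 < n)%N /\ (scaled_idx x n s <= n)%N /\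
    in_window x eps n (scaled_idx x n s).
Proof.
move=> x01 e0; near=> n.
have [n0 /andP[g0 g1]] : (0 < n)%N /\ 0 <= n%:R * x + s * rt n < n%:R.
  by near: n; exact: scaled_pos_range.
split=> //; split.
  move/(cellP _ _ _ n0) : (idx_cell n0 g0) => /andP[h2 _].
  by have := le_lt_trans h2 g1; rewrite ltr_nat => /ltnW.
rewrite /in_window; near: n.
by have /cvgrPdist_lt := scaled_idx_div_cvg s x01; apply.
Unshelve. all: by end_near.
Qed.

(** Both indices lie within [O(sqrt n)] of [n x], and the logarithm of
    [mode_term] moves by [O(1/n)] per step. *)
Lemma mode_ratio_cvg (x s s' : R) : 0 < x < 1 ->
  mode_term n (scaled_idx x n s) / mode_term n (scaled_idx x n s') @[n --> \oo] --> (1 : R).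
Proof.
move=> /[dup] x01 /andP[x0 x1].
pose eps := Num.min x (1 - x) / 2.
have e0 : 0 < eps by rewrite divr_gt0// lt_min x0 subr_gt0.
have ex : 2 * eps <= x by rewrite mulrC divfK// ge_min lexx.
have e1x : 2 * eps <= 1 - x by rewrite mulrC divfK// ge_min lexx orbT.
pose u n : R := `|rt n * ((scaled_idx x n s)%:R / n%:R - x) -
               rt n * ((scaled_idx x n s')%:R / n%:R - x)| * (rt n)^-1 / eps.
have u0 : u n @[n --> \oo] --> 0.
  rewrite (_ : 0 = `|s - s'| * 0 / eps); last by rewrite mulr0 mul0r.
  apply: cvgM; last exact: cvg_cst.
  apply: cvgM; last exact: inv_sqrt_nat_cvg0.
  by apply: cvg_norm; apply: cvgB; exact: scaled_idx_cvg.
have e1 : expR (u n) @[n --> \oo] --> (1 : R).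
  rewrite -[X in _ --> X]expR0; apply: (continuous_cvg _ _ u0); exact: continuous_expR.
have e2 : expR (- u n) @[n --> \oo] --> (1 : R).
  rewrite -[X in _ --> X]expR0 -oppr0; apply: continuous_cvg; first exact: continuous_expR.
  exact: cvgN.
apply: (squeeze_cvgr _ e2 e1); near=> n.
have [n0 [K1 W1]] : (0 < n)%N /\ (scaled_idx x n s <= n)%N /\
    in_window x eps n (scaled_idx x n s) by near: n; exact: in_window_near.
have [_ [K2 W2]] : (0 < n)%N /\ (scaled_idx x n s' <= n)%N /\
    in_window x eps n (scaled_idx x n s') by near: n; exact: in_window_near.
have [k1 k2 k3] := in_window_bounds ex e1x e0 n0 K1 W1.
have [k1' k2' k3'] := in_window_bounds ex e1x e0 n0 K2 W2.
have en0 : 0 < eps * n%:R by rewrite mulr_gt0// ltr0n.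
have rn0 : 0 < rt n by rewrite sqrtr_gt0 ltr0n.
have nE : n%:R = rt n * rt n :> R by rewrite -expr2 sqr_sqrtr ?ler0n.
have uE : u n =
    `|(scaled_idx x n s)%:R - (scaled_idx x n s')%:R| / (eps * n%:R).
  rewrite /u; set r := rt n in rn0 nE *; set A := (scaled_idx x n s)%:R.
  set B := (scaled_idx x n s')%:R.
  rewrite -mulrBr (_ : A / n%:R - x - (B / n%:R - x) = (A - B) / n%:R); last by ring.
  rewrite normrM (ger0_norm (ltW rn0)).
  rewrite normrM [X in _ * (_ * X)]ger0_norm ?invr_ge0 ?ler0n//.
  by rewrite nE; field; rewrite !gt_eqF.
rewrite uE; apply/andP; split.
  rewrite ler_pdivlMr ?mode_term_gt0// mulrC -ler_pdivlMr ?expR_gt0// -expRN opprK.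
  by rewrite mulrC distrC; exact: mode_term_ratio.
by rewrite ler_pdivrMr ?mode_term_gt0//; exact: mode_term_ratio.
Unshelve. all: by end_near.
Qed.
End Scale.

(** * Laplace's method for sums of binomial weights *)

Section Laplace.
Context {R : realType}.
Local Notation mu := (@lebesgue_measure R).
Local Notation rt n := (Num.sqrt (n%:R : R)).

Lemma bern_var_dist (x u : R) : 0 < x < 1 -> 0 <= u <= 1 ->
  `|u * (1 - u) - x * (1 - x)| <= `|u - x|.
Proof.
move=> x01 u01; rewrite (_ : _ - _ = (u - x) * (1 - u - x)); last by ring.
rewrite normrM -[leRHS]mulr1 ler_wpM2l// ler_norml; lra.
Qed.

Lemma between_dist (p z x u : R) : Num.min p z <= u <= Num.max p z ->
  `|u - x| <= `|z - x| + `|p - x|.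
Proof.
rewrite /Num.min /Num.max; case: ltP => _ /andP[h1 h2];
  rewrite ler_norml; apply/andP; split;
  have := ler_norm (z - x); have := ler_norm (p - x);
  have := ler_norm (- (z - x)); have := ler_norm (- (p - x)); rewrite !normrN; lra.
Qed.

(** Both Gaussian bounds apply, with [w] the variance at [x] plus or minus the
    distance of the parameters from [x], which tends to zero. *)
Lemma binom_mode_ratio_cvg (x s tau : R) (p : R ^nat) : 0 < x < 1 ->
  rt n * (p n - (scaled_idx x n s)%:R / n%:R) @[n --> \oo] --> tau ->
  binom_term n (scaled_idx x n s) (p n) (1 - p n) / mode_term n (scaled_idx x n s)
    @[n --> \oo] --> expR (- (tau ^+ 2 / (2 * (x * (1 - x))))).
Proof.
move=> x01 ptau; have [x0 x1] := andP x01.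
pose v := x * (1 - x).
have v0 : 0 < v by rewrite mulr_gt0// subr_gt0.
have zx := scaled_idx_div_cvg s x01.
have px : p n @[n --> \oo] --> x.
  have h0 : p n - (scaled_idx x n s)%:R / n%:R @[n --> \oo] --> 0.
    apply: (@cvg_div_sqrt_nat _ (fun n => p n - (scaled_idx x n s)%:R / n%:R) 0 tau).
    by under eq_cvg do rewrite subr0.
  have : (p n - (scaled_idx x n s)%:R / n%:R) + (scaled_idx x n s)%:R / n%:R
      @[n --> \oo] --> 0 + x by exact: cvgD.
  by rewrite add0r; under eq_cvg do rewrite subrK.
pose e n := `|(scaled_idx x n s)%:R / n%:R - x| + `|p n - x|.
have e0 : e n @[n --> \oo] --> 0.
  rewrite -[X in _ --> X]addr0; apply: cvgD.
    by rewrite -(@normr0 _ R) -(subrr x); apply: cvg_norm; apply: cvgB => //; exact: cvg_cst.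
  by rewrite -[X in _ --> X](@normr0 _ R) -(subrr x); apply: cvg_norm; apply: cvgB => //; exact: cvg_cst.
pose N n := (rt n * (p n - (scaled_idx x n s)%:R / n%:R)) ^+ 2.
have Ntau : N n @[n --> \oo] --> tau ^+ 2 by rewrite expr2; apply: cvgM.
have expcvg (w : R ^nat) : w n @[n --> \oo] --> v ->
    expR (- (N n / (2 * w n))) @[n --> \oo] --> expR (- (tau ^+ 2 / (2 * v))).
  move=> wv; apply: continuous_cvg; first exact: continuous_expR.
  apply: cvgN; apply: cvgM => //; apply: cvgV; first by rewrite gt_eqF// mulr_gt0.
  by apply: cvgM => //; exact: cvg_cst.
(* [e n] bounds the distance to [x] of every point between [p n] and [k / n]. *)
have hi : v + e n @[n --> \oo] --> v.
  by rewrite -[X in _ --> X]addr0; apply: cvgD => //; exact: cvg_cst.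
have lo : v - e n @[n --> \oo] --> v.
  by rewrite -[X in _ --> X]subr0; apply: cvgB => //; exact: cvg_cst.
apply: (squeeze_cvgr _ (expcvg _ lo) (expcvg _ hi)).
have p01 : \forall n \near \oo, 0 < p n < 1.
  near=> n; apply/andP; split; near: n.
    by move/cvgrPdist_lt : px => /(_ x x0); apply: filterS => n; rewrite ltr_norml; lra.
  move/cvgrPdist_lt : px => /(_ (1 - x)); rewrite subr_gt0 => /(_ x1).
  by apply: filterS => n; rewrite ltr_norml; lra.
pose eps := Num.min x (1 - x) / 2.
have eps0 : 0 < eps by rewrite divr_gt0// lt_min x0 subr_gt0.
have ex : 2 * eps <= x by rewrite mulrC divfK// ge_min lexx.
have e1x : 2 * eps <= 1 - x by rewrite mulrC divfK// ge_min lexx orbT.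
near=> n.
have [n0 [K1 W1]] : (0 < n)%N /\ (scaled_idx x n s <= n)%N /\
    in_window x eps n (scaled_idx x n s) by near: n; exact: in_window_near.
have [k1 k2 k3] := in_window_bounds ex e1x eps0 n0 K1 W1.
have pn : 0 < p n < 1 by near: n.
have ev : 0 < v - e n.
  rewrite subr_gt0; near: n; move/cvgrPdist_lt : e0 => /(_ v v0).
  by apply: filterS => n; rewrite sub0r normrN; apply: le_lt_trans; exact: ler_norm.
have en0 : 0 <= e n by rewrite addr_ge0.
have NE w : N n / w = n%:R * (p n - (scaled_idx x n s)%:R / n%:R) ^+ 2 / w.
  by rewrite /N exprMn sqr_sqrtr// ler0n.
have z01 : 0 < ((scaled_idx x n s)%:R / n%:R : R) < 1.
  have [kk0 kkn] := andP k1.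
  by rewrite divr_gt0 ?ltr0n//= ltr_pdivrMr ?ltr0n// mul1r ltr_nat.
have ub u : Num.min (p n) ((scaled_idx x n s)%:R / n%:R) <= u <=
    Num.max (p n) ((scaled_idx x n s)%:R / n%:R) ->
    v - e n <= u * (1 - u) <= v + e n.
  move=> uu; rewrite -ler_distl; apply: (le_trans _ (between_dist x uu)).
  apply: bern_var_dist => //; move: uu pn z01; rewrite /Num.min /Num.max; case: ltP => _; lra.
rewrite !NE ler_pdivlMr ?mode_term_gt0// ler_pdivrMr ?mode_term_gt0//.
rewrite ![expR _ * _]mulrC; apply/andP; split.
  by apply: binom_term_lower => // u /ub /andP[].
by apply: binom_term_upper => //; [rewrite ltr_wpDr|move=> u /ub /andP[]].
Unshelve. all: by end_near.
Qed.

(** Domination combines Pinsker's inequality with the hypothesis that [p]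
    stays away from the diagonal by [c0 |x - k/n|]; the pointwise limit is the
    product of the limits of [w], of the exponential factor and of the ratio of
    maxima. Dividing by the maximum at the centre keeps the unknown constant of
    Stirling's formula out of the statement. *)
Lemma laplace_sum (x eps c0 theta omega : R) (p w : nat -> nat -> R) :
  0 < x < 1 -> 0 < eps -> 2 * eps <= x -> 2 * eps <= 1 - x -> 0 < c0 ->
  theta != 0 ->
  (\forall n \near \oo, forall k, (k <= n)%N -> in_window x eps n k ->
     [/\ 0 < p n k < 1, c0 * `|x - k%:R / n%:R| <= `|p n k - k%:R / n%:R| &
         0 <= w n k <= 1]) ->
  (forall s, rt n * (p n (scaled_idx x n s) - (scaled_idx x n s)%:R / n%:R)
     @[n --> \oo] --> theta * s) ->
  (forall s, w n (scaled_idx x n s) @[n --> \oo] --> omega) ->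
  (\sum_(k < n.+1 | in_window x eps n k)
     w n k * binom_term n k (p n k) (1 - p n k)) / 
     (rt n * mode_term n (scaled_idx x n 0)) @[n --> \oo] -->
  omega * Num.sqrt (pi / (theta ^+ 2 / (2 * (x * (1 - x))))).
Proof.
move=> x01 eps0 ex e1x c00 theta0 pw ptau wom; have [x0 x1] := andP x01.
have v0 : 0 < x * (1 - x) by rewrite mulr_gt0// subr_gt0.
pose b := theta ^+ 2 / (2 * (x * (1 - x))).
have t2 : 0 < theta ^+ 2 by rewrite exprn_even_gt0.
have b0 : 0 < b by apply: divr_gt0 => //; apply: mulr_gt0.
pose c n k := if in_window x eps n k then
  w n k * binom_term n k (p n k) (1 - p n k) /
  (rt n * mode_term n (scaled_idx x n 0)) else 0.
have := @lattice_sum_cvg R x (2 * c0 ^+ 2) (expR 2) c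
  (fun s => omega * expR (- (b * s ^+ 2))) x01.
rewrite mulr_gt0 ?exprn_gt0// => /(_ isT).
have mE : measurable_fun setT (fun s : R => expR (- (b * s ^+ 2))).
  by apply/measurable_EFinP; have := integrable_gauss b0; exact: measurable_int.
move=> /(_ (measurable_funM (measurable_cst _) mE)).
have -> : (\int[mu]_s (omega * expR (- (b * s ^+ 2)))%:E)%E =
    (omega * Num.sqrt (pi / b))%:E.
  under eq_integral do rewrite EFinM.
  by rewrite integralZl//= ?integral_gauss//; exact: integrable_gauss.
have sumE n : \sum_(k < n.+1) c n k = (\sum_(k < n.+1 | in_window x eps n k)
     w n k * binom_term n k (p n k) (1 - p n k)) /
     (rt n * mode_term n (scaled_idx x n 0)).
  by rewrite mulr_suml [RHS]big_mkcond.
under eq_cvg do rewrite sumE.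
move=> H; apply: (fine_cvg (H _ _)) => {H} [|s].
  near=> n => k kn; rewrite /c; case: ifPn => win; last first.
    by rewrite mulr0 mulr_ge0 ?expR_ge0.
  have [n0 [K1 W1]] : (0 < n)%N /\ (scaled_idx x n 0 <= n)%N /\
      in_window x eps n (scaled_idx x n 0) by near: n; exact: in_window_near.
  have [k1 k2 k3] := in_window_bounds ex e1x eps0 n0 K1 W1.
  have [k1' k2' k3'] := in_window_bounds ex e1x eps0 n0 kn win.
  have [p01 pk /andP[wk0 wk1]] : [/\ 0 < p n k < 1,
     c0 * `|x - k%:R / n%:R| <= `|p n k - k%:R / n%:R| & 0 <= w n k <= 1].
    by move: k kn win {k1' k2' k3'}; near: n.
  have en : 1 <= eps * n%:R.
    by rewrite mulrC -ler_pdivrMr//; near: n; exact: nbhs_infty_ger.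
  have rn0 : 0 < rt n by rewrite sqrtr_gt0 ltr0n.
  have m0 := @mode_term_gt0 R _ _ k1.
  have bt0 : 0 <= binom_term n k (p n k) (1 - p n k).
    by case/andP: p01 => p0 p1; rewrite binom_term_ge0 ?subr_ge0// ltW.
  split; first by apply: divr_ge0; [exact: mulr_ge0|by rewrite ltW// mulr_gt0].
  set m := mode_term n (scaled_idx x n 0) in m0 *.
  rewrite (_ : rt n * (_ / _) = w n k * (binom_term n k (p n k) (1 - p n k) / m)); last first.
    by field; rewrite !gt_eqF.
  apply: (@le_trans _ _ (binom_term n k (p n k) (1 - p n k) / m)).
    by rewrite ler_piMl// divr_ge0// ltW.
  rewrite ler_pdivrMr//.
  have Q := @binom_term_upper R n k (p n k) (1/4) k1' p01.
  have /(_ _ _)/le_trans := Q; apply; [by []| |].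
    move=> u _; have := sqr_ge0 (u - 1/2); lra.
  (* In the window [k] is within [eps n] of [n x] and the central index within
     one, so the exponent is at most [(eps n + 1) / (eps n) <= 2]. *)
  have D : mode_term n k <= expR 2 * m.
    apply: le_trans (mode_term_ratio (lt_le_trans ltr01 en) k2' k3' k2 k3) _.
    rewrite ler_wpM2r ?(ltW m0)// ler_expR ler_pdivrMr ?(lt_le_trans ltr01 en)//.
    have [_ /andP[g0 _]] : (0 < n)%N /\ 0 <= n%:R * x + 0 * rt n < n%:R.
      by near: n; exact: scaled_pos_range.
    have := scaled_idx_close n0 g0; rewrite mul0r addr0 => cl.
    have nn0 : 0 < n%:R :> R by rewrite ltr0n.
    have wn : `|k%:R - n%:R * x| <= eps * n%:R.
      have -> : k%:R - n%:R * x = n%:R * (k%:R / n%:R - x) by field; rewrite gt_eqF.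
      by rewrite normrM (ger0_norm (ltW nn0)) mulrC ler_pM2r// distrC ltW.
    apply: le_trans (ler_distD (n%:R * x) _ _) _; rewrite [X in _ + X]distrC; lra.
  rewrite [leRHS]mulrAC; apply: ler_pM; [exact: mode_term_ge0|exact: expR_ge0|by []|].
  rewrite ler_expR lerN2.
  have -> : (k%:R - n%:R * x) / rt n = - (rt n * (x - k%:R / n%:R)).
    have nE : n%:R = rt n * rt n :> R by rewrite -expr2 sqr_sqrtr ?ler0n.
    by set r := rt n in rn0 nE *; rewrite nE; field; rewrite gt_eqF.
  rewrite sqrrN exprMn sqr_sqrtr ?ler0n//.
  have : (c0 * `|x - k%:R / n%:R|) ^+ 2 <= `|p n k - k%:R / n%:R| ^+ 2.
    by rewrite lerXn2r ?nnegrE// mulr_ge0// ltW.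
  rewrite exprMn !real_normK ?num_real// => h.
  have nn0 : 0 <= n%:R :> R by rewrite ler0n.
  have := ler_wpM2l nn0 h; lra.
have L1 := binom_mode_ratio_cvg x01 (ptau s).
have L2 := mode_ratio_cvg s 0 x01.
have L3 : w n (scaled_idx x n s) * (binom_term n (scaled_idx x n s)
      (p n (scaled_idx x n s)) (1 - p n (scaled_idx x n s)) /
      mode_term n (scaled_idx x n s)) *
    (mode_term n (scaled_idx x n s) / mode_term n (scaled_idx x n 0)) @[n --> \oo] -->
    omega * expR (- (b * s ^+ 2)).
  rewrite (_ : omega * _ = omega * expR (- ((theta * s) ^+ 2 / (2 * (x * (1 - x))))) * 1).
    by apply: cvgM => //; apply: cvgM.
  by rewrite mulr1 exprMn mulrAC.
apply: cvg_trans L3; apply: near_eq_cvg; near=> n.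
have [n0 [K1 W1]] : (0 < n)%N /\ (scaled_idx x n s <= n)%N /\
    in_window x eps n (scaled_idx x n s) by near: n; exact: in_window_near.
have [_ [K2 W2]] : (0 < n)%N /\ (scaled_idx x n 0 <= n)%N /\
    in_window x eps n (scaled_idx x n 0) by near: n; exact: in_window_near.
have [k1 _ _] := in_window_bounds ex e1x eps0 n0 K1 W1.
have [k2 _ _] := in_window_bounds ex e1x eps0 n0 K2 W2.
have m1 := @mode_term_gt0 R _ _ k1; have m2 := @mode_term_gt0 R _ _ k2.
have rn0 : 0 < rt n by rewrite sqrtr_gt0 ltr0n.
by rewrite /c W1; field; rewrite !gt_eqF.
Unshelve. all: by end_near.
Qed.
End Laplace.

(** * Normalisation by the binomial distribution *)

Section Normalisation.
Context {R : realType}.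
Local Notation rt n := (Num.sqrt (n%:R : R)).

Lemma succ_expRN_cvg0 (a : R) : 0 < a ->
  n.+1%:R * expR (- (n%:R * a)) @[n --> \oo] --> 0.
Proof.
move=> a0.
have h : 4 / a ^+ 2 * ((rt n)^-1 * (rt n)^-1) @[n --> \oo] --> 0.
  rewrite -[X in _ --> X](mulr0 (4 / a ^+ 2)); apply: cvgM; first exact: cvg_cst.
  by rewrite -[X in _ --> X](mulr0 0); apply: cvgM; exact: inv_sqrt_nat_cvg0.
apply: (squeeze_cvgr _ (cvg_cst 0) h); near=> n.
have n0 : (0 < n)%N by near: n; exact: nbhs_infty_gt.
have nn0 : 1 <= n%:R :> R by rewrite ler1n.
rewrite mulr_ge0 ?expR_ge0//= -invfM -expr2 sqr_sqrtr ?ler0n// expRN.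
have na : 0 <= n%:R * a by rewrite mulr_ge0 ?ler0n ?ltW.
(* The quadratic term of the exponential series beats the factor [n + 1]. *)
have := @expR_ge1Dxn R (n%:R * a) 1 na.
rewrite (_ : (1.+1)`! = 2)%N// => h2.
have h3 : 0 < (n%:R * a) ^+ 2 / 2 by rewrite divr_gt0// exprn_gt0// mulr_gt0// ltr0n.
rewrite ler_pdivrMr ?expR_gt0//.
apply: (@le_trans _ _ (4 / a ^+ 2 * n%:R^-1 * ((n%:R * a) ^+ 2 / 2))).
  rewrite (_ : _ * _ = 2 * n%:R); first by rewrite -natr1; lra.
  have an : a != 0 by rewrite gt_eqF.
  have nn : n%:R != 0 :> R by rewrite gt_eqF// ltr0n.
  by field; rewrite an nn.
rewrite ler_wpM2l//; last by lra.
by rewrite mulr_ge0 ?invr_ge0 ?ler0n// divr_ge0// exprn_ge0// ltW.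
Unshelve. all: by end_near.
Qed.

(** Pinsker's inequality in the interior; the two boundary weights
    [(1 - x)^n] and [x^n] need their own exponential rate. *)
Lemma binom_tail_le (x eps : R) (n k : nat) : 0 < x < 1 -> 0 < eps -> (0 < n)%N ->
  (k <= n)%N -> ~~ in_window x eps n k ->
  binom_term n k x (1 - x) <=
  expR (- (n%:R * Num.min (2 * eps ^+ 2) (Num.min x (1 - x)))).
Proof.
move=> x01 eps0 n0 kn; rewrite /in_window -leNgt => win; have [x0 x1] := andP x01.
have nn0 : 0 < n%:R :> R by rewrite ltr0n.
have bnd u : Num.min (2 * eps ^+ 2) (Num.min x (1 - x)) <= u ->
    expR (- (n%:R * u)) <= expR (- (n%:R * Num.min (2 * eps ^+ 2) (Num.min x (1 - x)))).
  by move=> h; rewrite ler_expR lerN2 ler_wpM2l// ltW.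
have expn u : 0 <= 1 - u -> (1 - u) ^+ n <= expR (- (n%:R * u)).
  move=> u1; rewrite -mulrN expRM_natl lerXn2r ?nnegrE ?expR_ge0//.
  exact: expR_ge1Dx.
have [k0|k0] := posnP k.
  apply: le_trans (bnd x _); last by rewrite !ge_min lexx orbT.
  rewrite /binom_term k0 bin0 expr0 !mul1r subn0; apply: expn; lra.
have [kn'|nk] := ltnP k n; last first.
  have -> : k = n by apply/eqP; rewrite eqn_leq kn.
  apply: le_trans (bnd (1 - x) _); last by rewrite !ge_min lexx !orbT.
  rewrite /binom_term binn subnn expr0 mulr1 mul1r -{1}(subKr 1 x); apply: expn; lra.
apply: le_trans (bnd (2 * eps ^+ 2) _); last by rewrite ge_min lexx.
have k1 : (0 < k < n)%N by rewrite k0.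
have /(_ _ _)/le_trans := @binom_term_upper R n k x (1/4) k1 x01; apply; [by []| |].
  by move=> u _; have := sqr_ge0 (u - 1/2); lra.
apply: (@le_trans _ _ (1 * expR (- (n%:R * (x - k%:R / n%:R) ^+ 2 / (2 * (1 / 4)))))).
  rewrite ler_wpM2r ?expR_ge0// /mode_term binom_term_le1//.
  by rewrite divr_ge0 ?ler0n//= ler_pdivrMr// mul1r ler_nat.
rewrite mul1r ler_expR lerN2 -(real_normK (num_real (x - _))).
have : eps ^+ 2 <= `|x - k%:R / n%:R| ^+ 2 by rewrite lerXn2r ?nnegrE// ltW.
set d := _ ^+ 2 => /(ler_wpM2l (ltW nn0)); set e := eps ^+ 2; lra.
Qed.

Lemma binom_window_cvg1 (x eps : R) : 0 < x < 1 -> 0 < eps ->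
  \sum_(k < n.+1 | in_window x eps n k) binom_term n k x (1 - x) @[n --> \oo] --> (1 : R).
Proof.
move=> x01 eps0; have [x0 x1] := andP x01.
pose a := Num.min (2 * eps ^+ 2) (Num.min x (1 - x)).
have a0 : 0 < a by rewrite !lt_min x0 subr_gt0 x1 mulr_gt0 ?exprn_gt0.
have h : 1 - n.+1%:R * expR (- (n%:R * a)) @[n --> \oo] --> (1 : R).
  by rewrite -[X in _ --> X]subr0; apply: cvgB; [exact: cvg_cst|exact: succ_expRN_cvg0].
apply: (squeeze_cvgr _ h (cvg_cst (1 : R))); near=> n.
have n0 : (0 < n)%N by near: n; exact: nbhs_infty_gt.
have S := @sum_binom_term R n x.
have SE : \sum_(k < n.+1 | in_window x eps n k) binom_term n k x (1 - x) =
   1 - \sum_(k < n.+1 | ~~ in_window x eps n k) binom_term n k x (1 - x).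
  move: S; rewrite (bigID (fun k : 'I_n.+1 => in_window x eps n k))/= => S.
  by rewrite -[X in _ = X - _]S addrK.
rewrite SE lerD2l lerN2 lerBlDr lerDl; apply/andP; split; last first.
  by apply: sumr_ge0 => i _; rewrite binom_term_ge0// ?subr_ge0 ltW.
apply: (@le_trans _ _ (\sum_(k < n.+1) expR (- (n%:R * a)))).
  rewrite big_mkcond; apply: ler_sum => i _; case: ifPn => win; last exact: expR_ge0.
  by apply: binom_tail_le => //; rewrite -ltnS.
by rewrite sumr_const card_ord -[leLHS]mulr_natl.
Unshelve. all: by end_near.
Qed.

(** The quotient of [laplace_sum] for the given [p] and for the constant
    [p = x], whose slope relative to the diagonal is [-1]. *)
Lemma laplace_local (x eps c0 theta omega : R) (p w : nat -> nat -> R) :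
  0 < x < 1 -> 0 < eps -> 2 * eps <= x -> 2 * eps <= 1 - x -> 0 < c0 ->
  theta != 0 ->
  (\forall n \near \oo, forall k, (k <= n)%N -> in_window x eps n k ->
     [/\ 0 < p n k < 1, c0 * `|x - k%:R / n%:R| <= `|p n k - k%:R / n%:R| &
         0 <= w n k <= 1]) ->
  (forall s, rt n * (p n (scaled_idx x n s) - (scaled_idx x n s)%:R / n%:R)
     @[n --> \oo] --> theta * s) ->
  (forall s, w n (scaled_idx x n s) @[n --> \oo] --> omega) ->
  \sum_(k < n.+1 | in_window x eps n k)
     w n k * binom_term n k (p n k) (1 - p n k) @[n --> \oo] --> omega / `|theta|.
Proof.
move=> x01 eps0 ex e1x c00 theta0 pw ptau wom; have [x0 x1] := andP x01.
have A := laplace_sum x01 eps0 ex e1x c00 theta0 pw ptau wom.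
(* For constant [p = x] the difference [p - k/n] has slope [-1] in [s]. *)
have m10 : -1 != 0 :> R by rewrite oppr_eq0 oner_eq0.
have B := @laplace_sum R x eps 1 (-1) 1 (fun _ _ => x) (fun _ _ => 1)
  x01 eps0 ex e1x ltr01 m10.
have c1 (s : R) : (1 : R) @[n --> \oo] --> (1 : R) by exact: cvg_cst.
have {}B := B _ _ c1.
have /B{}B : \forall n \near \oo, forall k, (k <= n)%N -> in_window x eps n k ->
     [/\ 0 < x < 1, 1 * `|x - k%:R / n%:R| <= `|x - k%:R / n%:R| & 0 <= (1 : R) <= 1].
  by near=> n => k _ _; rewrite mul1r x01 ler01 !lexx.
have /B{}B : forall s, rt n * (x - (scaled_idx x n s)%:R / n%:R) @[n --> \oo] --> -1 * s.
  move=> s; rewrite mulN1r.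
  have : - (rt n * ((scaled_idx x n s)%:R / n%:R - x)) @[n --> \oo] --> - s.
    by apply: cvgN; exact: scaled_idx_cvg.
  by under eq_cvg do rewrite -mulrN opprB.
have v0 : 0 < x * (1 - x) by rewrite mulr_gt0// subr_gt0.
have B0 : 1 * Num.sqrt (pi / ((-1) ^+ 2 / (2 * (x * (1 - x))))) != 0 :> R.
  by rewrite mul1r gt_eqF// sqrtr_gt0 divr_gt0 ?pi_gt0// sqrrN expr1n divr_gt0// mulr_gt0.
have M := binom_window_cvg1 x01 eps0.
have limE : omega / `|theta| =
    omega * Num.sqrt (pi / (theta ^+ 2 / (2 * (x * (1 - x))))) *
    (1 * Num.sqrt (pi / ((-1) ^+ 2 / (2 * (x * (1 - x))))))^-1 * 1.
  rewrite mulr1 mul1r sqrrN expr1n.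
  set S := Num.sqrt (pi / (1 / _)).
  have S0 : S != 0.
    by rewrite gt_eqF// sqrtr_gt0 divr_gt0 ?pi_gt0// divr_gt0// mulr_gt0.
  have -> : pi / (theta ^+ 2 / (2 * (x * (1 - x)))) =
      (theta^-1) ^+ 2 * (pi / (1 / (2 * (x * (1 - x))))).
    by field; rewrite theta0 !gt_eqF// subr_gt0.
  by rewrite sqrtrM ?sqr_ge0// sqrtr_sqr normfV -/S -!mulrA divff// mulr1.
have C : (\sum_(k < n.+1 | in_window x eps n k)
      w n k * binom_term n k (p n k) (1 - p n k)) /
      (rt n * mode_term n (scaled_idx x n 0)) *
    ((\sum_(k < n.+1 | in_window x eps n k) 1 * binom_term n k x (1 - x)) /
      (rt n * mode_term n (scaled_idx x n 0)))^-1 *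
    \sum_(k < n.+1 | in_window x eps n k) binom_term n k x (1 - x)
    @[n --> \oo] --> omega / `|theta|.
  by rewrite limE; apply: cvgM; [apply: cvgM; [exact: A|exact: cvgV]|exact: M].
have Spos : \forall n \near \oo,
    0 < \sum_(k < n.+1 | in_window x eps n k) binom_term n k x (1 - x).
  by move/cvgrPdist_lt : M => /(_ 1 ltr01); apply: filterS => n; rewrite ltr_norml; lra.
apply: cvg_trans C; apply: near_eq_cvg; near=> n.
have [n0 [K1 W1]] : (0 < n)%N /\ (scaled_idx x n 0 <= n)%N /\
    in_window x eps n (scaled_idx x n 0) by near: n; exact: in_window_near.
have [k1 _ _] := in_window_bounds ex e1x eps0 n0 K1 W1.
have m0 := @mode_term_gt0 R _ _ k1.
have rn0 : 0 < rt n by rewrite sqrtr_gt0 ltr0n.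
under [X in _ * (X / _)^-1]eq_bigr do rewrite mul1r.
have S0 : \sum_(k < n.+1 | in_window x eps n k) binom_term n k x (1 - x) != 0.
  by rewrite gt_eqF//; near: n.
move: S0; set S := \sum_(_ < _ | _) binom_term n _ x _ => S0.
set T := \sum_(_ < _ | _) _.
by field; rewrite S0 !gt_eqF.
Unshelve. all: by end_near.
Qed.
End Normalisation.

(** * Sums of binomial weights at a crossing of the diagonal *)

Section Crossing.
Context {R : realType}.
Local Notation rt n := (Num.sqrt (n%:R : R)).

(** Squeezed by [exp (- d / (1 - d)) <= 1 - d <= exp (- d)]. *)
Lemma cvg_pow_expRN (d : R ^nat) (K : nat -> nat) (l : R) :
  (\forall n \near \oo, 0 <= d n) -> d n @[n --> \oo] --> 0 ->
  (K n)%:R * d n @[n --> \oo] --> l -> (1 - d n) ^+ K n @[n --> \oo] --> expR (- l).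
Proof.
move=> d0 dcvg Kd.
have hi : expR (- ((K n)%:R * d n)) @[n --> \oo] --> expR (- l).
  by apply: continuous_cvg; [exact: continuous_expR|exact: cvgN].
have lo : expR (- ((K n)%:R * d n * (1 - d n)^-1)) @[n --> \oo] --> expR (- l).
  apply: continuous_cvg; [exact: continuous_expR|apply: cvgN].
  rewrite -[X in _ --> X]mulr1; apply: cvgM => //.
  rewrite -[X in _ --> X]invr1; apply: cvgV; first exact: oner_neq0.
  by rewrite -[X in _ --> X]subr0; apply: cvgB => //; exact: cvg_cst.
apply: (squeeze_cvgr _ lo hi); near=> n.
have dn0 : 0 <= d n by near: n.
have dn1 : d n < 1.
  near: n; move/cvgrPdist_lt : dcvg => /(_ 1 ltr01).
  by apply: filterS => n; rewrite sub0r normrN; apply: le_lt_trans; exact: ler_norm.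
have e0 : 0 < 1 - d n by rewrite subr_gt0.
rewrite -mulrA -mulrN expRM_natl; apply/andP; split.
  rewrite lerXn2r ?nnegrE ?expR_ge0 ?(ltW e0)//.
  rewrite expRN -[leRHS]invrK lef_pV2 ?posrE ?expR_gt0 ?invr_gt0//.
  apply: le_trans (expR_ge1Dx _).
  by rewrite le_eqVlt; apply/orP; left; apply/eqP; field; rewrite gt_eqF.
rewrite -mulrN expRM_natl lerXn2r ?nnegrE ?expR_ge0 ?(ltW e0)//.
exact: expR_ge1Dx.
Unshelve. all: by end_near.
Qed.

(** Differentiability with both points free. The increment of [h] between
    [(k-1)/n] and [k/n] is needed along a sequence of points that moves with [n],
    which a derivative at [x] alone does not control. *)
Definition strict_derivative (h : R -> R) (x alpha : R) :=
  forall eta, 0 < eta -> exists2 delta, 0 < delta &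
    forall a b, `|a - x| < delta -> `|b - x| < delta ->
      `|h b - h a - alpha * (b - a)| <= eta * `|b - a|.

Lemma strict_derivative_cvg (h : R -> R) (x alpha l : R) (m u v : R ^nat) :
  strict_derivative h x alpha -> u n @[n --> \oo] --> x -> v n @[n --> \oo] --> x ->
  m n * (u n - v n) @[n --> \oo] --> l ->
  m n * (h (u n) - h (v n)) @[n --> \oo] --> alpha * l.
Proof.
move=> hd ux vx ml.
suff E : m n * (h (u n) - h (v n) - alpha * (u n - v n)) @[n --> \oo] --> 0.
  have : m n * (h (u n) - h (v n) - alpha * (u n - v n)) + alpha * (m n * (u n - v n))
    @[n --> \oo] --> 0 + alpha * l by apply: cvgD => //; apply: cvgM => //; exact: cvg_cst.
  rewrite add0r; apply: cvg_trans; apply: near_eq_cvg; near=> n.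
  by rewrite !mulrBr; ring.
apply/cvgrPdist_le => e e0.
have l0 : 0 < `|l| + 1 by rewrite ltr_wpDl.
have [delta delta0 hdelta] := hd (e / (`|l| + 1)) (divr_gt0 e0 l0).
near=> n; rewrite sub0r normrN normrM.
have un : `|u n - x| < delta.
  by rewrite distrC; near: n; move/cvgrPdist_lt : ux; apply.
have vn : `|v n - x| < delta.
  by rewrite distrC; near: n; move/cvgrPdist_lt : vx; apply.
apply: le_trans (ler_wpM2l (normr_ge0 _) (hdelta _ _ vn un)) _.
rewrite mulrCA -normrM.
have ml1 : `|m n * (u n - v n)| <= `|l| + 1.
  have : `|l - m n * (u n - v n)| < 1.
    by near: n; move/cvgrPdist_lt : ml => /(_ 1 ltr01).
  have := ler_distD l (m n * (u n - v n)) 0; rewrite !subr0 distrC; lra.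
by rewrite -[leRHS](@divfK _ (`|l| + 1)) ?gt_eqF// ler_wpM2l// divr_ge0 ?ltW.
Unshelve. all: by end_near.
Qed.

(** The weight is [(q/p)^k] times a binomial weight with parameter [p]. The first
    factor contributes [exp (- alpha)]; in the second, [p - k/n] has slope
    [alpha - 1] at [x], which is a transversal crossing of the diagonal because
    [alpha] is not [1]. *)
Lemma crossing_sum_cvg (h : R -> R) (x alpha : R) : 0 < x < 1 -> h x = x ->
  (forall z, 0 <= h z) -> {homo h : a b / a <= b} ->
  strict_derivative h x alpha -> alpha != 1 ->
  \forall eps \near 0^'+,
    \sum_(k < n.+1 | in_window x eps n k)
      binom_term n k (h ((k%:R - 1) / n%:R)) (1 - h (k%:R / n%:R))
    @[n --> \oo] --> expR (- alpha) / `|1 - alpha|.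
Proof.
move=> x01 hx h0 hmono hd alpha1; have [x0 x1] := andP x01.
pose eta := `|1 - alpha| / 2.
have a10 : 0 < `|1 - alpha| by rewrite normr_gt0 subr_eq0 eq_sym.
have eta0 : 0 < eta by rewrite divr_gt0.
have [delta delta0 hdelta] := hd eta eta0.
(* [L] is a Lipschitz constant of [h] at [x], used to keep [h] inside the
   unit interval on the window. *)
pose L := `|alpha| + eta.
have L0 : 0 < L by rewrite ltr_wpDl.
near=> eps.
have eps0 : 0 < eps by [].
have ex : 2 * eps <= x.
  by rewrite mulrC -ler_pdivlMr//; near: eps; apply: nbhs_right_le; rewrite divr_gt0.
have e1x : 2 * eps <= 1 - x.
  rewrite mulrC -ler_pdivlMr//; near: eps; apply: nbhs_right_le.
  by rewrite divr_gt0// subr_gt0.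
have ed : eps <= delta by near: eps; exact: nbhs_right_le.
have eL1 : L * eps <= x.
  by rewrite mulrC -ler_pdivlMr//; near: eps; apply: nbhs_right_le; rewrite divr_gt0.
have eL2 : L * eps <= 1 - x.
  rewrite mulrC -ler_pdivlMr//; near: eps; apply: nbhs_right_le.
  by rewrite divr_gt0// subr_gt0.
have hz z : `|x - z| < eps -> `|h z - x - alpha * (z - x)| <= eta * `|x - z|.
  move=> zx; have zx' : `|z - x| < delta by rewrite distrC (lt_le_trans zx).
  have := hdelta x z _ zx'; rewrite subrr normr0 hx => /(_ delta0).
  by rewrite [in leRHS]distrC.
have hz01 z : `|x - z| < eps -> 0 < h z < 1.
  move=> zx.
  have : `|h z - x| <= L * `|x - z|.
    rewrite -(subrK (alpha * (z - x)) (h z - x)) (le_trans (ler_normD _ _))//.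
    by rewrite /L mulrDl addrC; apply: lerD; [rewrite normrM (distrC z)|exact: hz].
  have : L * `|x - z| < L * eps by rewrite ltr_pM2l.
  move: (L * _) => A AL; rewrite ler_norml; lra.
have hzz z : `|x - z| < eps -> eta * `|x - z| <= `|h z - z|.
  move=> /hz zx; rewrite (_ : h z - z = (1 - alpha) * (x - z) + (h z - x - alpha * (z - x))); last by ring.
  apply: le_trans (lerB_normD _ _); rewrite normrM lerBrDr.
  apply: le_trans (lerD (lexx _) zx) _; rewrite -mulrDl.
  by rewrite /eta -splitr.
have -> : expR (- alpha) / `|1 - alpha| = expR (- alpha) / `|alpha - 1| by rewrite distrC.
have a10' : alpha - 1 != 0 by rewrite subr_eq0.
pose w n k := (h ((k%:R - 1) / n%:R) / h (k%:R / n%:R)) ^+ k.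
have := @laplace_local R x eps eta (alpha - 1) (expR (- alpha))
  (fun n k => h (k%:R / n%:R)) w x01 eps0 ex e1x eta0 a10'.
move=> H; have : \sum_(k < n.+1 | in_window x eps n k)
     w n k * binom_term n k (h (k%:R / n%:R)) (1 - h (k%:R / n%:R)) @[n --> \oo] --> expR (- alpha) / `|alpha - 1|.
  apply: H.
  - near=> n => k kn win; split; [exact: hz01|exact: hzz|].
    have /andP[p0 p1] := hz01 _ win.
    have n0 : 0 < n%:R :> R by rewrite ltr0n; near: n; exact: nbhs_infty_gt.
    have q0 : 0 <= h ((k%:R - 1) / n%:R) / h (k%:R / n%:R) by rewrite divr_ge0.
    rewrite exprn_ge0//= exprn_ile1// ler_pdivrMr// mul1r hmono//.
    by rewrite ler_pM2r ?invr_gt0// lerBlDr lerDl.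
  - move=> s.
    have zx := scaled_idx_div_cvg s x01.
    have zs := @scaled_idx_cvg R x s x01.
    have xx : x @[n --> \oo] --> x by exact: cvg_cst.
    have H1 := strict_derivative_cvg hd zx xx zs.
    have : rt n * (h ((scaled_idx x n s)%:R / n%:R) - h x) -
       rt n * ((scaled_idx x n s)%:R / n%:R - x) @[n --> \oo] --> alpha * s - s by apply: cvgB.
    rewrite mulrBl mul1r; apply: cvg_trans; apply: near_eq_cvg; near=> n.
    by rewrite hx; ring.
  - move=> s.
    have zx := scaled_idx_div_cvg s x01.
    pose z n : R := (scaled_idx x n s)%:R / n%:R.
    pose y n : R := ((scaled_idx x n s)%:R - 1) / n%:R.
    have in0 : (n%:R : R)^-1 @[n --> \oo] --> 0.
      have : (rt n)^-1 * (rt n)^-1 @[n --> \oo] --> (0 * 0 : R).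
        by apply: cvgM; exact: inv_sqrt_nat_cvg0.
      rewrite mul0r; apply: cvg_trans; apply: near_eq_cvg; near=> n.
      by rewrite -invfM -expr2 sqr_sqrtr ?ler0n.
    have yx : y n @[n --> \oo] --> x.
      have : z n - (n%:R)^-1 @[n --> \oo] --> x - 0 by apply: cvgB.
      by rewrite subr0; apply: cvg_trans; apply: near_eq_cvg; near=> n; rewrite /y mulrBl mul1r.
    have zy1 : n%:R * (z n - y n) @[n --> \oo] --> (1 : R).
      have : (1 : R) @[n --> \oo] --> (1 : R) by exact: cvg_cst.
      apply: cvg_trans; apply: near_eq_cvg; near=> n.
      have n0 : n%:R != 0 :> R by rewrite gt_eqF// ltr0n; near: n; exact: nbhs_infty_gt.
      by rewrite /z /y; field.
    have pq := strict_derivative_cvg hd zx yx zy1.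
    (* The constant scale [1] turns the differentiability lemma into continuity. *)
    have zx1 : 1 * (z n - x) @[n --> \oo] --> 1 * (x - x).
      by apply: cvgM; [exact: cvg_cst|apply: cvgB => //; exact: cvg_cst].
    have hzx : h (z n) @[n --> \oo] --> x.
      have xx : x @[n --> \oo] --> x by exact: cvg_cst.
      have H1 := strict_derivative_cvg hd zx xx zx1.
      have : 1 * (h (z n) - h x) + x @[n --> \oo] --> alpha * (1 * (x - x)) + x.
        by apply: cvgD.
      rewrite subrr !mulr0 add0r; apply: cvg_trans; apply: near_eq_cvg; near=> n.
      by rewrite hx mul1r subrK.
    have x0n : x != 0 by rewrite gt_eqF.
    have ihz : (h (z n))^-1 @[n --> \oo] --> x^-1 by apply: cvgV.
    have n0 : \forall n \near \oo, n%:R != 0 :> R.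
      by near=> n; rewrite gt_eqF// ltr0n; near: n; exact: nbhs_infty_gt.
    have d0 : (h (z n) - h (y n)) / h (z n) @[n --> \oo] --> 0.
      have : (n%:R)^-1 * (n%:R * (h (z n) - h (y n))) * (h (z n))^-1
        @[n --> \oo] --> 0 * (alpha * 1) * x^-1 by apply: cvgM => //; apply: cvgM.
      rewrite !mul0r; apply: cvg_trans; apply: near_eq_cvg; near=> n.
      by rewrite mulKf//; near: n.
    have Kd : (scaled_idx x n s)%:R * ((h (z n) - h (y n)) / h (z n)) @[n --> \oo] --> alpha.
      have : z n * (n%:R * (h (z n) - h (y n)) * (h (z n))^-1)
        @[n --> \oo] --> x * (alpha * 1 * x^-1) by apply: cvgM => //; apply: cvgM.
      rewrite mulr1 mulrC divfK//; apply: cvg_trans; apply: near_eq_cvg; near=> n.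
      by rewrite !mulrA /z divfK//; near: n.
    have zn0 : \forall n \near \oo, 0 < h (z n).
      by move/cvgrPdist_lt : hzx => /(_ x x0); apply: filterS => n; rewrite ltr_norml; lra.
    have : (1 - (h (z n) - h (y n)) / h (z n)) ^+ (scaled_idx x n s) @[n --> \oo] --> expR (- alpha).
      apply: cvg_pow_expRN => //; near=> n.
      rewrite divr_ge0// subr_ge0 hmono// /y mulrBl lerBlDr lerDl mul1r invr_ge0.
      exact: ler0n.
    apply: cvg_trans; apply: near_eq_cvg; near=> n; rewrite /w -/(z n) -/(y n).
    have hz0 : h (z n) != 0 by rewrite gt_eqF//; near: n.
    by congr (_ ^+ _); rewrite mulrBl divff// opprB addrC subrK.
apply: cvg_trans; apply: near_eq_cvg; near=> n.
apply: eq_bigr => k win; have /andP[p0 p1] := hz01 _ win.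
rewrite /w /binom_term expr_div_n; field.
by rewrite expf_neq0// gt_eqF.
Unshelve. all: by end_near.
Qed.
End Crossing.

(** * Distribution functions with a density *)

Section Density.
Context {R : realType}.
Local Notation mu := (@lebesgue_measure R).
Context (F f : R -> R) (Ff : has_density F f).

Lemma density_increment (a b : R) : a <= b ->
  (F b - F a)%:E = (\int[mu]_(u in `]a, b]) (f u)%:E)%E.
Proof.
move=> ab; have [mf f0 FE] := Ff.
have S : `]-oo, b]%classic = `]-oo, a] `|` `]a, b]%classic :> set R.
  by rewrite -itv_bndbnd_setU// bnd_simp.
have := FE b; rewrite S ge0_integral_setU//=; last 3 first.
- by apply/measurable_EFinP; exact: measurable_funTS.
- by move=> y _; rewrite lee_fin.
- apply/disj_setPS => y [] /=; rewrite !in_itv/= => h1 /andP[h2 _].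
  by have := le_lt_trans h1 h2; rewrite ltxx.
rewrite -FE EFinB => ->.
by rewrite addeAC subee// add0e.
Qed.

Lemma density_nondecreasing : {homo F : a b / a <= b}.
Proof.
move=> a b ab; rewrite -subr_ge0 -lee_fin density_increment//.
by have [_ f0 _] := Ff; apply: integral_ge0 => u _; rewrite lee_fin.
Qed.

(** The increment is an integral of [f], which is within [eta] of [f y] on the
    whole interval of integration. *)
Lemma density_strict_derivative (y : R) : {for y, continuous f} ->
  strict_derivative F y (f y).
Proof.
move=> fy eta eta0; have [mf f0 FE] := Ff.
have /cvgrPdist_le/(_ eta eta0) := fy.
move=> [delta /= delta0 hdelta]; exists delta => //.
have key a b : a <= b -> `|a - y| < delta -> `|b - y| < delta ->
    `|F b - F a - f y * (b - a)| <= eta * `|b - a|.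
  move=> ab ay yb.
  have fnear u : `]a, b]%classic u -> `|f y - f u| <= eta.
    rewrite /= in_itv/= => /andP[au ub]; apply: hdelta => /=.
    by move: ay yb; rewrite !ltr_norml; lra.
  have mI : measurable_fun `]a, b] (EFin \o f).
    by apply/measurable_EFinP; exact: measurable_funTS.
  have muI : mu `]a, b] = (b - a)%:E.
    rewrite lebesgue_measure_itv/= lte_fin; case: ltgtP ab => [_ _|//|-> _].
      by rewrite EFinB.
    by rewrite subrr.
  have up : ((F b - F a)%:E <= ((f y + eta) * (b - a))%:E)%E.
    rewrite density_increment// EFinM -muI -integral_cst//.
    apply: ge0_le_integral => //=; first by move=> u _; rewrite lee_fin.
    by move=> u /fnear; rewrite lee_fin ler_norml; lra.
  have dn : (((f y - eta) * (b - a))%:E <= (F b - F a)%:E)%E.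
    rewrite density_increment// .
    have [fe|fe] := leP 0 (f y - eta); last first.
      apply: (@le_trans _ _ 0%E); last by apply: integral_ge0 => u _; rewrite lee_fin.
      by rewrite lee_fin nmulr_rle0// subr_ge0.
    rewrite EFinM -muI -integral_cst//.
    apply: ge0_le_integral => //=.
    by move=> u /fnear; rewrite lee_fin ler_norml; lra.
  move: up dn; rewrite !lee_fin => up dn.
  by rewrite (ger0_norm (_ : 0 <= b - a)) ?subr_ge0// ler_norml; lra.
move=> a b ay yb; have /orP[ab|ba] := le_total a b; first exact: key.
have -> : F b - F a - f y * (b - a) = - (F a - F b - f y * (a - b)) by ring.
by rewrite normrN (distrC b); exact: key.
Qed.

End Density.

Section Cdf.
Context {R : realType} {d : measure_display} {T : measurableType d}
  (P : probability T R) (X : {RV P >-> R}) (F f : R -> R).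
Context (XF : forall y, cdf X y = (F y)%:E) (Ff : has_density F f).
Local Notation mu := (@lebesgue_measure R).

Lemma itvNy_open_bigcup (a : R) :
  `]-oo, a[%classic = \bigcup_n `]-oo, a - n.+1%:R^-1]%classic.
Proof.
apply/seteqP; split => [w|w [n _]] /=; rewrite !in_itv/= => wa; last first.
  by apply: (le_lt_trans wa); rewrite ltrBlDr ltrDl invr_gt0.
have aw : 0 < a - w by rewrite subr_gt0.
have [n _ hn] := near_infty_natSinv_lt (PosNum aw).
by exists n => //=; rewrite in_itv/= lerBrDr -lerBrDl ltW//; exact: (hn n (leqnn n)).
Qed.

Lemma itvNy_nd (a : R) : {homo (fun n => `]-oo, a - n.+1%:R^-1]%classic) :
  n m / (n <= m)%N >-> (n <= m)%O}.
Proof.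
move=> n m nm; apply/subsetPset => w /=; rewrite !in_itv/= => /le_trans; apply.
by rewrite lerB// lef_pV2 ?posrE ?ltr0n// ler_nat.
Qed.

(** There are no atoms: both the probability and the integral over an open
    half-line are limits over the closed half-lines inside it. *)
Lemma prob_lt_cdf (a : R) : P (X @^-1` `]-oo, a[) = (F a)%:E.
Proof.
have [mf f0 FE] := Ff.
have h1 : (F (a - n.+1%:R^-1))%:E @[n --> \oo] --> distribution P X `]-oo, a[%classic.
  rewrite itvNy_open_bigcup.
  under eq_cvg do rewrite -XF.
  apply: (@nondecreasing_cvg_mu _ _ _ (distribution P X)
    (fun n => `]-oo, a - n.+1%:R^-1]%classic) _ _ (itvNy_nd a)).
    by move=> n; exact: measurable_itv.
  by apply: bigcupT_measurable => n; exact: measurable_itv.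
have h2 : (F (a - n.+1%:R^-1))%:E @[n --> \oo] --> (F a)%:E.
  rewrite FE -integral_itv_bndo_bndc; last first.
    by apply/measurable_EFinP; exact: measurable_funTS.
  rewrite itvNy_open_bigcup; under eq_cvg do rewrite FE.
  apply: ge0_nondecreasing_set_cvg_integral => //; first exact: itvNy_nd.
    by move=> n; apply/measurable_EFinP; exact: measurable_funTS.
  by move=> n w _; rewrite lee_fin.
exact: (cvg_unique _ h1 h2).
Qed.

Lemma prob_ge_cdf (a : R) : P (X @^-1` `[a, +oo[) = (1 - F a)%:E.
Proof.
have -> : X @^-1` `[a, +oo[ = ~` (X @^-1` `]-oo, a[).
  by rewrite preimage_setC setCitvl.
rewrite probability_setC ?prob_lt_cdf//.
by apply: measurable_funPTI => //; exact: measurable_itv.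
Qed.

(** The value at zero is the probability of a negative value, since zero is not
    an atom. *)
Lemma cdf_nonneg_at0 : (forall w, 0 <= X w) -> F 0 = 0.
Proof.
move=> X0; apply: EFin_inj; rewrite -prob_lt_cdf (_ : _ @^-1` _ = set0) ?measure0//.
by rewrite -subset0 => w /=; rewrite in_itv/= ltNge X0.
Qed.

Lemma cdf_le1 (y : R) : F y <= 1.
Proof. by rewrite -lee_fin -prob_lt_cdf probability_le1//; apply: measurable_funPTI. Qed.

End Cdf.

(** * The law of the equilibrium set *)

Section EquilibriumLaw.
Context {R : realType} {d : measure_display} {T : measurableType d}.

Section Patterns.
Context (Y : nat -> T -> R) (r c : R) (c0 : 0 <= c).

Definition level (n : nat) (z : int) : R := r - c * (z%:~R / n%:R).

Definition above (n : nat) (z : int) (w : T) : {set 'I_n} :=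
  [set i : 'I_n | r <= Y i w + c * (z%:~R / n%:R)]%SET.

Lemma in_above n z w (i : 'I_n) : (i \in above n z w) = (level n z <= Y i w).
Proof. by rewrite inE /level lerBlDr. Qed.

Lemma above_pred n (k : nat) w : above n (k%:Z - 1) w \subset above n k%:Z w.
Proof.
apply/fintype.subsetP => i; rewrite !inE => /le_trans; apply; rewrite lerD2l.
apply: ler_wpM2l => //; apply: ler_wpM2r; first by rewrite invr_ge0.
by rewrite ler_int gerDl.
Qed.

(** The constraint on the signal of player [i] under which the players in [S]
    are exactly those above both levels. Independence speaks of sets indexed by
    all naturals, hence the membership test on values. *)
Definition pattern_set n (k : nat) (S : {set 'I_n}) (i : nat) : set R :=
  if i \in [seq val j | j <- enum S] then `[level n (k%:Z - 1), +oo[%classic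
  else `]-oo, level n k%:Z[%classic.

Lemma pattern_setE n (k : nat) (S : {set 'I_n}) (i : 'I_n) :
  pattern_set k S i = if i \in S then `[level n (k%:Z - 1), +oo[%classic
  else `]-oo, level n k%:Z[%classic.
Proof. by rewrite /pattern_set mem_map ?mem_enum//; exact: val_inj. Qed.

Lemma measurable_pattern_set n k S i : measurable (@pattern_set n k S i).
Proof. by rewrite /pattern_set; case: ifP => _; exact: measurable_itv. Qed.

Definition pattern n (k : nat) (S : {set 'I_n}) : set T :=
  \big[setI/setT]_(i <- iota 0 n) (Y i @^-1` (pattern_set k S i)).

(** The pattern includes [S] in the smaller set and the larger set in [S]; as the
    two sets are nested, all three are equal. *)
Lemma patternP n k (S : {set 'I_n}) w :
  pattern k S w <-> (above n k%:Z w == S) && (above n (k%:Z - 1) w == S).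
Proof.
rewrite /pattern -bigcap_seq; split => [H|/andP[/eqP A1 /eqP A2] i /=].
  have H' i : if i \in S then i \in above n (k%:Z - 1) w else i \notin above n k%:Z w.
    have := H i; rewrite /= mem_iota leq0n ltn_ord pattern_setE => /(_ isT).
    by rewrite !in_above; case: ifP => _ /=; rewrite in_itv/= ?andbT// ltNge.
  have S1 : S \subset above n (k%:Z - 1) w.
    by apply/fintype.subsetP => i iS; have := H' i; rewrite iS.
  have S2 : above n k%:Z w \subset S.
    by apply/fintype.subsetP => i; apply: contraLR => /negbTE iS; have := H' i; rewrite iS.
  have S3 := above_pred n k w.
  by rewrite !finset.eqEsubset S1 S2 (fintype.subset_trans S1 S3) (fintype.subset_trans S3 S2).
rewrite mem_iota leq0n add0n /= => ni; rewrite -[i]/(val (Ordinal ni)).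
move: (Ordinal ni) => {ni}i; rewrite pattern_setE.
case: ifPn => /=; rewrite in_itv/=.
  by rewrite -{1}A2 in_above andbT.
by rewrite -{1}A1 in_above ltNge.
Qed.

(** Equal cardinals of nested sets mean equal sets, so at most one pattern of
    size [k] occurs, and one occurs exactly at an equilibrium. *)
Lemma equilibria_pattern n w (k : 'I_n.+1) :
  (k \in equilibria Y r c n w)%:R =
  \sum_(S : {set 'I_n} | #|S| == k) \1_(pattern k S) w :> R.
Proof.
rewrite inE /count_above -/(above n k%:Z w) -/(above n (k%:Z - 1) w).
have eqA : (#|above n k%:Z w| == k) && (#|above n (k%:Z - 1) w| == k) =
   (#|above n k%:Z w| == k) && (above n (k%:Z - 1) w == above n k%:Z w).
  apply: andb_id2l => /eqP kE; rewrite eqEcard.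
  rewrite above_pred/= kE eqn_leq.
  by rewrite andb_idl// => _; have := subset_leq_card (above_pred n k w); rewrite kE.
rewrite eqA; have [kE|kE] := boolP (#|above n k%:Z w| == k); last first.
  rewrite big1// => S /eqP SE; rewrite indicE memNset// => /patternP /andP[/eqP h _].
  by move: kE; rewrite h SE eqxx.
rewrite (bigD1 (above n k%:Z w))//= big1 ?addr0.
  rewrite indicE; congr (_%:R); congr nat_of_bool.
  by apply/idP/idP; rewrite inE; [move=> h; apply/patternP|move/patternP/andP => []];
     rewrite ?eqxx.
move=> S /andP[_ SA]; rewrite indicE memNset// => /patternP /andP[/eqP h _].
by rewrite h eqxx in SA.
Qed.

Lemma card_equilibria_near x eps n w :
  #|equilibria_near Y r c x eps n w|%:R =
  \sum_(k < n.+1 | in_window x eps n k)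
    \sum_(S : {set 'I_n} | #|S| == k) \1_(pattern k S) w :> R.
Proof.
rewrite -sum1_card natr_sum big_mkcond [RHS]big_mkcond/=; apply: eq_bigr => k _.
rewrite -equilibria_pattern [k \in equilibria_near _ _ _ _ _ _ _]inE -/(in_window x eps n k).
by case: (k \in equilibria _ _ _ _ _); case: in_window.
Qed.
End Patterns.

Context (P : probability T R) (Y : nat -> {RV P >-> R}) (F f : R -> R) (r c : R).
Context (c0 : 0 <= c) (indY : mutually_independent Y)
  (Y_cdf : forall i y, cdf (Y i) y = (F y)%:E) (Ff : has_density F f).

Lemma measurable_pattern n k (S : {set 'I_n}) :
  measurable (pattern Y r c k S).
Proof.
rewrite /pattern; apply: bigsetI_measurable => i _.
by apply: measurable_funPTI => //; exact: measurable_pattern_set.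
Qed.

Lemma prob_pattern n k (S : {set 'I_n}) :
  P (pattern Y r c k S) =
  ((1 - F (level r c n (k%:Z - 1))) ^+ #|S| * F (level r c n k%:Z) ^+ (n - #|S|))%:E.
Proof.
rewrite /pattern indY ?iota_uniq//; last exact: measurable_pattern_set.
have -> : iota 0 n = index_iota 0 n by rewrite /index_iota subn0.
rewrite big_mkord (eq_bigr (fun i : 'I_n => (if i \in S then
   1 - F (level r c n (k%:Z - 1)) else F (level r c n k%:Z))%:E)); last first.
  move=> i _; rewrite pattern_setE; case: ifP => _.
    by rewrite (prob_ge_cdf (Y_cdf i) Ff).
  by rewrite (prob_lt_cdf (Y_cdf i) Ff).
rewrite prodEFin; congr EFin.
rewrite (bigID (mem S))/=; congr (_ * _).
  under eq_bigr => i iS do rewrite iS.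
  by rewrite prodr_const.
under eq_bigr => i /negbTE iS do rewrite iS.
rewrite (eq_bigl (mem (~: S)%SET)); last by move=> i; rewrite !inE.
by rewrite prodr_const cardsCs finset.setCK card_ord.
Qed.

Lemma measurable_card_equilibria_near x eps n :
  measurable_fun setT (fun w => #|equilibria_near Y r c x eps n w|%:R : R).
Proof.
under eq_fun do rewrite card_equilibria_near//.
under eq_fun do rewrite big_mkcond/=.
apply: measurable_sum => k; case: in_window => //.
under eq_fun do rewrite big_mkcond/=.
apply: measurable_sum => S; case: eqP => // _.
by apply: measurable_indic; exact: measurable_pattern.
Qed.

Lemma expected_card_equilibria_near x eps n :
  ('E_P [fun w => #|equilibria_near Y r c x eps n w|%:R])%E =
  (\sum_(k < n.+1 | in_window x eps n k)
    binom_term n k (1 - F (level r c n (k%:Z - 1))) (F (level r c n k%:Z)))%:E.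
Proof.
have mpat n' k (S : {set 'I_n'}) :
    measurable_fun setT (fun w => (\1_(pattern Y r c k S) w : R)%:E).
  by apply/measurable_EFinP; apply: measurable_indic; exact: measurable_pattern.
rewrite expectation.unlock.
under eq_integral => w _.
  rewrite card_equilibria_near// -sumEFin.
  under eq_bigr do rewrite -sumEFin -big_filter.
  rewrite -big_filter; over.
rewrite ge0_integral_sum//=; last 2 first.
- by move=> k; apply: emeasurable_sum => S; exact: mpat.
- by move=> k w _; apply: sume_ge0 => S _; rewrite lee_fin.
rewrite big_filter -sumEFin; apply: eq_bigr => k _.
rewrite ge0_integral_sum//= big_filter.
have kn : (k <= n)%N by rewrite -ltnS.
transitivity (\sum_(S : {set 'I_n} | #|S| == k)
   ((1 - F (level r c n (k%:Z - 1))) ^+ k * F (level r c n k%:Z) ^+ (n - k))%:E)%E.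
  apply: eq_bigr => S /eqP SE; rewrite integral_indic//; last exact: measurable_pattern.
  by rewrite setIT [LHS]prob_pattern SE.
rewrite sumEFin sumr_const -mulr_natl /binom_term -mulrA; congr (_%:R * _)%:E.
have := card_draws 'I_n k; rewrite card_ord => <-.
by rewrite cardsE.
Qed.

(** Markov's inequality at level one for the number of equilibria. *)
Lemma existence_le_expected x eps n :
  (P [set w | exists k, k \in equilibria_near Y r c x eps n w] <=
   'E_P [fun w => #|equilibria_near Y r c x eps n w|%:R])%E.
Proof.
rewrite expectation.unlock; set A := [set w | _].
have AE : A = (fun w => #|equilibria_near Y r c x eps n w|%:R : R) @^-1` `]0, +oo[.
  apply/seteqP; split=> w /=; rewrite in_itv/= andbT ltr0n => h.
    by case: h => k kw; apply/card_gt0P; exists k.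
  by move/card_gt0P : h => [k kw]; exists k.
have mA : measurable A.
  by rewrite AE -[_ @^-1` _]setTI; apply: measurable_card_equilibria_near.
have -> : P A = (\int[P]_w (\1_A w)%:E)%E by rewrite integral_indic// setIT.
apply: ge0_le_integral => //=.
- by apply/measurable_EFinP; exact: measurable_indic.
- by apply/measurable_EFinP; exact: measurable_card_equilibria_near.
- move=> w _; rewrite lee_fin indicE; have [wA|wA] := boolP (w \in A) => //.
  by move: wA; rewrite inE AE /= in_itv/= andbT ltr0n ler1n.
Qed.
End EquilibriumLaw.

(** * Upper limits and convergence of the counts *)

Lemma le_limf_esup (T : choiceType) (X : filteredType T) (R : realType)
    (u v : X -> \bar R) (G : set (set X)) :
  (forall x, (u x <= v x)%E) -> (limf_esup u G <= limf_esup v G)%E.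
Proof.
move=> uv; rewrite !limf_esupE; apply: le_ereal_inf_tmp => _ [V GV <-].
apply: ge_ereal_inf; exists (ereal_sup [set u x | x in V]); first by exists V.
apply: ge_ereal_sup => _ [x Vx <-]; apply: (le_trans (uv x)).
by apply: ereal_sup_ubound; exists x.
Qed.

Lemma limf_esup_le_near (T : choiceType) (X : filteredType T) (R : realType)
    (u : X -> \bar R) (G : set (set X)) (l : \bar R) :
  G [set x | (u x <= l)%E] -> (limf_esup u G <= l)%E.
Proof.
move=> Gu; rewrite limf_esupE; apply: ge_ereal_inf.
exists (ereal_sup [set u x | x in [set x | (u x <= l)%E]]); first by exists [set x | (u x <= l)%E].
by apply: ge_ereal_sup => _ [x /= ux <-].
Qed.

Theorem proposition6p11 (R : realType) (d : measure_display)
    (T : measurableType d) (P : probability T R)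
    (r c : R) (c_gt0 : 0 < c)
    (Y : R -> nat -> {RV P >-> R}) (F f : R -> R -> R)
    (t : R) (t_ge0 : 0 <= t)
    (Y_ge0 : forall i w, 0 <= Y t i w)
    (Y_iid : iid (Y t))
    (Y_cdf : forall i y, cdf (Y t i) y = (F t y)%:E)
    (f_density : has_density (F t) (f t))
    (f_cont : {within `[0, +oo[%classic, continuous (f t)})
    (x : R) (x_gt0 : 0 < x) (x_lt1 : x < 1)
    (x_eq : x + F t (r - c * x) = 1)
    (alpha : R) (alpha_def : alpha = c * f t (r - c * x))
    (alpha_neq1 : alpha != 1) :
  let expected_count (eps : R) (n : nat) : \bar R :=
    ('E_P [fun w => #|equilibria_near (Y t) r c x eps n w|%:R])%E in
  let existence_prob (eps : R) (n : nat) : \bar R :=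
    P [set w | exists k, k \in equilibria_near (Y t) r c x eps n w] in
  let bound : R := expR (- alpha) / `|1 - alpha| in
  [/\ \forall eps \near 0^'+, cvg (expected_count eps n @[n --> \oo]),
      lim (expected_count eps n @[n --> \oo]) @[eps --> 0^'+] --> bound%:E &
      (limf_esup (fun eps => limn_esup (existence_prob eps)) 0^'+
         <= bound%:E)%E].
Proof.
move=> expected_count existence_prob bound.
have [indY _] := Y_iid.
pose y0 := r - c * x.
(* Continuity of the density is only assumed on the half-line, so [y0] must be
   an interior point; otherwise [F t] would vanish there. *)
have y0_gt0 : 0 < y0.
  rewrite ltNge; apply/negP => /(density_nondecreasing f_density).
  rewrite (cdf_nonneg_at0 (Y_cdf 0%N) f_density)// /y0; lra.
have fy0 : {for y0, continuous (f t)}.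
  apply: (@within_continuous_continuous _ _ _ 0 (y0 + 1)).
  - by rewrite addr_gt0.
  - apply: continuous_subspaceW f_cont => u /=; rewrite !in_itv/= andbT.
    by case/andP.
  - by rewrite in_itv/= y0_gt0 ltrDl ltr01.
pose h z := 1 - F t (r - c * z).
have hx : h x = x by rewrite /h; lra.
have h0 z : 0 <= h z by rewrite subr_ge0 (cdf_le1 (Y_cdf 0%N) f_density).
have hmono : {homo h : a b / a <= b}.
  move=> a b ab; rewrite /h lerD2l lerN2; apply: (density_nondecreasing f_density).
  by rewrite lerD2l lerN2 ler_pM2l.
have hd : strict_derivative h x alpha.
  move=> eta eta0; have ec0 : 0 < eta / c by rewrite divr_gt0.
  have [delta delta0 H] := density_strict_derivative f_density fy0 ec0.
  exists (delta / c); first by rewrite divr_gt0.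
  have sc a : `|r - c * a - y0| = c * `|a - x|.
    rewrite (_ : _ - y0 = c * (x - a)); last by rewrite /y0; ring.
    by rewrite normrM gtr0_norm// distrC.
  move=> a b ax bx; have := H (r - c * a) (r - c * b).
  rewrite !sc -!ltr_pdivlMl// ![c^-1 * _]mulrC => /(_ ax bx).
  rewrite (_ : r - c * b - (r - c * a) = - c * (b - a)); last by ring.
  rewrite normrM normrN (gtr0_norm c_gt0).
  rewrite (_ : eta / c * (c * `|b - a|) = eta * `|b - a|); last first.
    by rewrite mulrA divfK ?gt_eqF.
  rewrite /h alpha_def -/y0 -normrN.
  by apply: le_trans; rewrite le_eqVlt; apply/orP; left; apply/eqP; congr (`|_|); ring.
have x01 : 0 < x < 1 by rewrite x_gt0.
have near_cvg : \forall eps \near 0^'+,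
    expected_count eps n @[n --> \oo] --> bound%:E.
  near=> eps.
  have S : \sum_(k < n.+1 | in_window x eps n k)
      binom_term n k (h ((k%:R - 1) / n%:R)) (1 - h (k%:R / n%:R))
    @[n --> \oo] --> bound.
    by near: eps; exact: crossing_sum_cvg.
  have E n : expected_count eps n = (\sum_(k < n.+1 | in_window x eps n k)
      binom_term n k (h ((k%:R - 1) / n%:R)) (1 - h (k%:R / n%:R)))%:E.
    rewrite /expected_count.
    rewrite (expected_card_equilibria_near _ (ltW c_gt0) indY Y_cdf f_density).
    congr (_%:E); apply: eq_bigr => k _; rewrite /h /level subKr.
    by rewrite intrB.
  rewrite (_ : expected_count eps = fun n => (\sum_(k < n.+1 | in_window x eps n k)
      binom_term n k (h ((k%:R - 1) / n%:R)) (1 - h (k%:R / n%:R)))%:E); last exact/funext.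
  by apply: cvg_EFin => //; near=> n.
have near_lim : \forall eps \near 0^'+,
    lim (expected_count eps n @[n --> \oo]) = bound%:E.
  by apply: filterS near_cvg => eps; exact: cvg_lim.
split.
- by apply: filterS near_cvg => eps epsE; apply/cvg_ex; exists bound%:E.
- have : bound%:E @[eps --> (0 : R)^'+] --> bound%:E by exact: cvg_cst.
  apply: cvg_trans; apply: near_eq_cvg.
  by apply: filterS near_lim => eps ->.
- have near_le : \forall eps \near 0^'+,
      (limn_esup (existence_prob eps) <= bound%:E)%E.
    apply: filterS near_cvg => eps /cvg_limn_einf_sup [_ <-].
    apply: le_limf_esup => n.
    by apply: existence_le_expected; exact: ltW.
  exact: limf_esup_le_near near_le.
Unshelve. all: by end_near.
Qed.
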